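(* Let $m$ be a non-negative integer and $N>1$ an integer. Let $V'(N-1,2m+1,l)$ be the region obtained from the lattice hexagon with side lengths $2m+1,N-1,N-1,2m+1,N-1,N-1$ (clockwise from the top) by deleting the $l$-th lozenge, counted from the top, among the vertical lozenges whose vertical diagonal lies on the vertical line half a unit to the right of the hexagon's vertical symmetry axis (for a positive integer $l$ such that this lozenge exists). Then $$\operatorname{M}(V'(N-1,2m+1,l))=\frac{(m+1)_{N-1}(m+1)_{N-1}(N-1)_{N-1}}{(2m+2)_{N-1}(2m+N)_{N-1}(N-1)!}\cdot\sigma_{2}(N,m,l)\cdot\prod_{i=1}^{N-1}\prod_{j=1}^{N-1}\prod_{k=1}^{2m+1}\frac{i+j+k-1}{i+j+k-2},$$ where $$\sigma_2(N,m,l)=m\sum_{e=0}^{l-1}(-1)^{e}\binom{N-1}{e}\frac{(N-2e-1)(\frac12)_e}{(m+e)(m+N-e-1)(\frac32-N)_e}+(m+N)\sum_{e=0}^{l-1}(-1)^{e}\binom{N-1}{e}\frac{(N-2e-1)(\frac12)_e}{(m+e+1)(m+N-e)(\frac32-N)_e}.$$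
   Context: The triangular lattice is drawn with one family of lattice lines horizontal; $\operatorname{M}(R)$ is the number of lozenge tilings of $R$. A vertical lozenge is the union of an up-pointing unit triangle and the down-pointing unit triangle directly below it sharing its horizontal side; its vertical diagonal joins two lattice points. $(a)_0=1$, $(a)_e=a(a+1)\cdots(a+e-1)$.
   Formalization: For m = 0 the e = 0 term of the first sum in σ₂ is undefined as printed (m times a fraction with denominator factor m+e = 0); the formal statement cancels the factor m there, taking m/(m+e) = 1 at m = e = 0. For m > 0 the formula is as printed. *)

(* Defs.v *)
From mathcomp Require Import all_boot all_order all_algebra.
From mathcomp Require Import finmap zify ring.

Set Implicit Arguments.
Unset Strict Implicit.
Unset Printing Implicit Defensive.

Import Order.TTheory GRing.Theory Num.Theory.
Local Open Scope fset_scope.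
Local Open Scope ring_scope.

(* The lattice point (a, b) is a * (1, 0) + b * (1/2, sqrt 3 / 2): the first   *)
(* coordinate runs along the horizontal lattice lines, the second one counts   *)
(* horizontal lines upwards.                                                   *)
Notation point := (int * int)%type.

(* (v, true) is the up-pointing unit triangle whose lower left vertex is v;    *)
(* (v, false) is the down-pointing unit triangle sharing the right side of     *)
(* (v, true).                                                                  *)
Notation triangle := (point * bool)%type.

Definition vertices (t : triangle) : {fset point} :=
  let: (a, b, up) := t in
  if up then [fset (a, b); (a + 1, b); (a, b + 1)]
  else [fset (a + 1, b); (a, b + 1); (a + 1, b + 1)].

(* Two unit triangles share a side iff they have exactly two common vertices.  *)
Definition adjacent (t u : triangle) : bool :=
  #|` vertices t `&` vertices u| == 2%N.

Definition is_lozenge (R : {fset triangle}) (B : {set R}) : bool :=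
  [exists t : R, exists u : R, (B == [set t; u]%SET) && adjacent (val t) (val u)].

Definition is_lozenge_tiling (R : {fset triangle}) (P : {set {set R}}) : bool :=
  partition P [set: R] && [forall B in P, is_lozenge B].

Definition M (R : {fset triangle}) : nat :=
  #|[set P : {set {set R}} | is_lozenge_tiling P]|.

(* The hexagon with side lengths a, b, c, a, b, c, clockwise from the top side,*)
(* placed so that its bottom side joins (0, 0) to (a, 0).  Counterclockwise    *)
(* from there its corners are (0, 0), (a, 0), (a, c), (a - b, b + c),          *)
(* (- b, b + c), (- b, b).                                                     *)
Definition in_hexagon (a b c : nat) (v : point) : bool :=
  [&& - b%:Z <= v.1 <= a%:Z, 0 <= v.2 <= (b + c)%:Z
    & 0 <= v.1 + v.2 <= (a + c)%:Z].

(* All the points of [-b, a] x [0, b + c], which contains the hexagon.         *)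
Definition hexagon_box (a b c : nat) : seq point :=
  [seq (i%:Z - b%:Z, j%:Z) | i <- iota 0 (a + b).+1, j <- iota 0 (b + c).+1].

Definition hexagon (a b c : nat) : {fset triangle} :=
  [fset t in [seq (v, up) | v <- hexagon_box a b c, up <- [:: true; false]]
     | [forall v : vertices t, in_hexagon a b c (val v)]].

(* The vertical lozenge whose horizontal diagonal joins v to v + (1, 0).       *)
Definition vlozenge (v : point) : {fset triangle} :=
  [fset (v, true); ((v.1, v.2 - 1), false)].

Definition vlozenge_top (v : point) : point := (v.1, v.2 + 1).

(* Twice the horizontal Cartesian coordinate of v.                             *)
Definition abscissa2 (v : point) : int := 2 * v.1 + v.2.

(* The vertical symmetry axis of hexagon x n n has doubled abscissa x.  The    *)
(* vertical lozenges of the hexagon whose vertical diagonal lies half a unit   *)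
(* to the right of it are listed from top to bottom.                           *)
Definition right_lozenges (n x : nat) : seq point :=
  sort (fun v w => w.2 <= v.2)
    [seq v <- hexagon_box x n n
       | (vlozenge v `<=` hexagon x n n)
         && (abscissa2 (vlozenge_top v) == x%:Z + 1)].

(* Meaningful for 0 < l <= size (right_lozenges n x).                          *)
Definition V' (n x l : nat) : {fset triangle} :=
  hexagon x n n `\` vlozenge (nth (0, 0) (right_lozenges n x) l.-1).

Definition poch (a : rat) (e : nat) : rat := \prod_(i < e) (a + i%:R).

(* The value of m / (m + e) as a rational function of m, that is with common   *)
(* factors cancelled; it differs from the quotient in rat only for m = e = 0,  *)
(* where it is 1 and not 0 / 0 = 0.                                            *)
Definition div_self_add (m e : nat) : rat :=
  if e == 0%N then 1 else m%:R / (m + e)%:R.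

(* The factor m in front of the first sum is distributed over the terms, so    *)
(* that for m = 0 it cancels the denominator m + e of the term e = 0; see      *)
(* sigma2E for m > 0.                                                          *)
Definition sigma2 (N m l : nat) : rat :=
  \sum_(0 <= e < l)
     (-1) ^+ e * 'C(N.-1, e)%:R * div_self_add m e
     * ((N%:R - 2 * e%:R - 1) * poch (1 / 2) e)
     / ((m%:R + N%:R - e%:R - 1) * poch (3 / 2 - N%:R) e)
  + (m%:R + N%:R) * \sum_(0 <= e < l)
     (-1) ^+ e * 'C(N.-1, e)%:R
     * ((N%:R - 2 * e%:R - 1) * poch (1 / 2) e)
     / ((m%:R + e%:R + 1) * (m%:R + N%:R - e%:R) * poch (3 / 2 - N%:R) e).

Lemma sigma2E (N m l : nat) : (0 < m)%N ->
  sigma2 N m l =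
  m%:R * \sum_(0 <= e < l)
     (-1) ^+ e * 'C(N.-1, e)%:R
     * ((N%:R - 2 * e%:R - 1) * poch (1 / 2) e)
     / ((m%:R + e%:R) * (m%:R + N%:R - e%:R - 1) * poch (3 / 2 - N%:R) e)
  + (m%:R + N%:R) * \sum_(0 <= e < l)
     (-1) ^+ e * 'C(N.-1, e)%:R
     * ((N%:R - 2 * e%:R - 1) * poch (1 / 2) e)
     / ((m%:R + e%:R + 1) * (m%:R + N%:R - e%:R) * poch (3 / 2 - N%:R) e).
Proof.
move=> m_gt0; congr (_ + _); rewrite mulr_sumr; apply: eq_bigr => e _.
have -> : div_self_add m e = m%:R / (m%:R + e%:R).
  rewrite /div_self_add -natrD; case: eqP => // ->.
  by rewrite addn0 divff // pnatr_eq0 -lt0n.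
rewrite -[(m%:R + e%:R) * _ * _]mulrA [((m%:R + e%:R) * _)^-1]invfM !mulrA.
by move: (_^-1) (_^-1) => x y; ring.
Qed.

Lemma mem_hexagon_box (a b c : nat) (v : point) :
  (v \in hexagon_box a b c) = (- b%:Z <= v.1 <= a%:Z) && (0 <= v.2 <= (b + c)%:Z).
Proof.
apply/allpairsP/idP => [[[i j] [+ + ->]]|].
  by rewrite !mem_iota /fst /snd; lia.
case: v => p q h; exists (absz (p + b%:Z), absz q).
by split; rewrite ?mem_iota /fst /snd; move: h; rewrite /fst /snd => h;
  [lia | lia | congr (_, _); lia].
Qed.

Lemma in_hexagonE (a b c : nat) (t : triangle) :
  (t \in hexagon a b c) = all (in_hexagon a b c) (vertices t).
Proof.
have allE : [forall v : vertices t, in_hexagon a b c (val v)]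
            = all (in_hexagon a b c) (vertices t).
  apply/forallP/allP => [h v vt | h v]; last exact: h (valP v).
  exact: h [` vt].
rewrite in_fset inE allE andb_idl // => /allP h.
suff: t \in [seq (v, up) | v <- hexagon_box a b c, up <- [:: true; false]] by [].
apply/allpairsP; exists (t.1, t.2); split=> //=; last 2 first.
- by case: (t.2).
- by case: t {h allE}.
case: t h {allE} => -[p q] [] h; rewrite mem_hexagon_box /=.
  by have := h (p, q); rewrite !inE eqxx /= => /(_ isT) /and3P[-> ->].
have := h (p + 1, q); have := h (p, q + 1); rewrite !inE !eqxx ?orbT /=.
by move=> /(_ isT) + /(_ isT); rewrite /in_hexagon /=; lia.
Qed.

Lemma right_lozengesE (n m : nat) :
  right_lozenges n (2 * m).+1 =
  [seq (m%:Z - n%:Z + l%:Z, (2 * n)%:Z - (2 * l)%:Z + 1) | l <- iota 1 n].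
Proof.
set x := (2 * m).+1.
have memL v : (v \in [seq (m%:Z - n%:Z + l%:Z, (2 * n)%:Z - (2 * l)%:Z + 1)
                        | l <- iota 1 n])
    = [&& 2 * v.1 + v.2 == x%:Z, 0 < v.2 & v.2 < (2 * n)%:Z].
  apply/mapP/idP => [[l + ->] /= | h].
    by rewrite mem_iota /x; lia.
  exists (absz (v.1 - m%:Z + n%:Z)); first by rewrite mem_iota; move: h; rewrite /x; lia.
  by case: v h => p q /=; rewrite /x => h; congr (_, _); lia.
have memS v : (v \in [seq v <- hexagon_box x n n
       | (vlozenge v `<=` hexagon x n n)
         && (abscissa2 (vlozenge_top v) == x%:Z + 1)])
    = [&& 2 * v.1 + v.2 == x%:Z, 0 < v.2 & v.2 < (2 * n)%:Z].
  rewrite mem_filter mem_hexagon_box /abscissa2 /=.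
  rewrite fsubUset !fsub1set !in_hexagonE.
  have all3 (a b c : point) P : all P [fset a; b; c] = [&& P a, P b & P c].
    apply/allP/and3P => [h | [Pa Pb Pc] u]; last first.
      by rewrite !inE => /orP[/orP[]|] /eqP ->.
    by split; apply: h; rewrite !inE eqxx ?orbT.
  case: v => p q; rewrite !all3 /in_hexagon /= /x; lia.
have trT : transitive (fun v w : point => w.2 <= v.2).
  by move=> a b c h1 h2; apply: le_trans h2 h1.
rewrite /right_lozenges; set S := filter _ _ in memS *.
have uS : uniq S.
  apply/filter_uniq/allpairs_uniq; rewrite ?iota_uniq //.
  by move=> [i j] [k l] _ _ /= [h1 h2]; congr (_, _); lia.
have anti : {in sort (fun v w => w.2 <= v.2) S &, antisymmetric (fun v w : point => w.2 <= v.2)}.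
  move=> [a b] [c d]; rewrite !mem_sort !memS /= => h1 h2 h3.
  by congr (_, _); lia.
apply: (sorted_eq_in _ anti).
- by move=> a b c _ _ _; apply: trT.
- by apply: sort_sorted => a b; apply: le_total.
- rewrite sorted_map.
  apply: (@sub_sorted _ ltn); last exact: iota_ltn_sorted.
  by move=> a b /=; lia.
rewrite perm_sort; apply: uniq_perm => //.
  rewrite map_inj_uniq ?iota_uniq // => a b [h _]; lia.
by move=> v; rewrite memS memL.
Qed.

(* Main.v *)
(**
Nonintersecting top-to-bottom lattice paths turn the tilings of the hexagon with
the lozenge removed into the determinant of A - u v^T, where A is the symmetric
Toeplitz matrix with entries C(2n, n+i-j), and u and v count the paths from the
top side to the removed lozenge and from there to the bottom side.  Hence the
count is det A (1 - v^T A^-1 u).  The columns of A^-1 next to the boundary are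
explicit: their entries are, up to a scalar, (-1)^i C(d,i) (n+d-i)! (n-1+i)!,
because the Toeplitz equations for them say that a d-th finite difference of a
polynomial of degree less than d vanishes.  This also gives det A, that is,
MacMahon's formula.

Going down two rows multiplies u by z + 2 + 1/z and divides v by it, and A
commutes with z + 2 + 1/z up to boundary terms.  So v^T A^-1 u changes by a sum
of four products of scalar products of u or v with these explicit vectors, as in
the Christoffel-Darboux formula.  Near the symmetry axis each of these scalar
products reduces to a well-poised (Dixon) sum with a closed form, and each
change is the corresponding summand of sigma_2.
*)

Require Import Defs.
From mathcomp Require Import all_boot all_order all_algebra.
From mathcomp Require Import finmap zify ring.

Set Implicit Arguments.
Unset Strict Implicit.
Unset Printing Implicit Defensive.

Import Order.TTheory GRing.Theory Num.Theory.
Local Open Scope fset_scope.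
Local Open Scope ring_scope.

(** * Perfect matchings *)

(** Tilings and determinants are matched by a common recursion. The paths advance one at a time; the
    determinant is linear in the row of the moving path, and a forbidden move produces a zero row or
    two equal rows.

    The descent needs an initial value. It is taken on the axis at the top side itself: there u is
    the unit vector e_m and v is row m of A, so 1 - v^T A^-1 u = 0. Multiplying u by 1 + z goes one
    row down and half a unit to the right, to the first lozenge; the two boundary products left over
    are the summand e = 0.

    The boundary products pair odd rows 2l + 1 with kernel vectors of orders 2m and 2m + 1. Each
    kernel entry is a linear factor times a weight symmetric about an integer centre, while an odd
    row is centred half a unit away from it. Averaging over the reflection turns odd rows into even
    ones, centred like the weights, and this is where the well-poised sums come from. *)

Section PerfectMatchings.
Local Open Scope nat_scope.
Variables (T : finType) (e : rel T).
Hypotheses (eC : symmetric e) (e_irr : irreflexive e).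

Definition is_edge (B : {set T}) : bool :=
  [exists t, exists u, (B == [set t; u]) && e t u].

Definition matchings (A : {set T}) : {set {set {set T}}} :=
  [set P | partition P A && [forall B in P, is_edge B]].

Lemma in_matchings (A : {set T}) (P : {set {set T}}) :
  (P \in matchings A) = partition P A && [forall B in P, is_edge B].
Proof. by rewrite inE. Qed.

Lemma card_matchings0 : #|matchings set0| = 1.
Proof.
suff -> : matchings set0 = [set set0] by rewrite cards1.
apply/setP=> P; rewrite !inE; apply/andP/eqP => [[/and3P[/eqP cP _ P0] _]|->].
  apply/eqP; rewrite -subset0; apply/subsetP => B BP.
  suff B0 : B = set0 by rewrite -B0 BP in P0.
  by apply/eqP; rewrite -subset0 -cP; apply: bigcup_sup.
rewrite partition_set0 eqxx; split=> //.
by apply/forall_inP => B; rewrite inE.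
Qed.

Lemma edgeP (d : T) (B : {set T}) : is_edge B -> d \in B ->
  exists2 u, e d u & B = [set d; u].
Proof.
case/existsP=> t /existsP[u /andP[/eqP -> etu]]; rewrite !inE => /orP[]/eqP ->.
  by exists u.
by exists t; [rewrite eC | rewrite setUC].
Qed.

Lemma pair_inj (d u v : T) : e d u -> e d v -> [set d; u] = [set d; v] -> u = v.
Proof.
move=> edu edv uv; have : u \in [set d; v] by rewrite -uv !inE eqxx orbT.
by rewrite !inE => /orP[/eqP ud|/eqP //]; rewrite ud e_irr in edu.
Qed.

Lemma card_matchings_with (A : {set T}) (d u : T) :
  d \in A -> u \in A -> e d u ->
  #|[set P in matchings A | [set d; u] \in P]| = #|matchings (A :\: [set d; u])|.
Proof.
move=> dA uA edu; set B := [set d; u].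
have B0 : B != set0 by apply/set0Pn; exists d; rewrite !inE eqxx.
have BA : B \subset A by apply/subsetP => w; rewrite !inE => /orP[]/eqP ->.
have BN Q : Q \in matchings (A :\: B) -> B \notin Q.
  rewrite inE => /andP[/and3P[/eqP cQ _ _] _]; apply/negP => BQ.
  have : d \in cover Q by apply/bigcupP; exists B; rewrite // !inE eqxx.
  by rewrite cQ !inE eqxx.
rewrite -[RHS](@card_in_imset _ _ (fun Q => B |: Q)); last first.
  move=> Q R QM RM QR.
  by rewrite -[Q](setU1K (BN _ QM)) -[R](setU1K (BN _ RM)) QR.
congr #|pred_of_set _|; apply/setP => P; apply/idP/imsetP.
  rewrite !inE => /andP[/andP[pP eP] BP]; exists (P :\ B); last by rewrite setD1K.
  rewrite inE partitionD1 //=; apply/forall_inP => C.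
  by rewrite in_setD1 => /andP[_]; apply: (forall_inP eP).
case=> Q + ->; rewrite in_matchings !inE eqxx andbT => /andP[pQ eQ].
apply/andP; split.
  rewrite -[A](setID A B) (setIidPr BA); apply: partitionU1 => //.
  by rewrite disjoints_subset setCD subsetUr.
apply/forall_inP => C; rewrite !inE => /orP[/eqP -> |/(forall_inP eQ) //].
by apply/existsP; exists d; apply/existsP; exists u; rewrite eqxx.
Qed.

Lemma card_matchings_expand (A : {set T}) (d : T) : d \in A ->
  #|matchings A| = \sum_(u in A | e d u) #|matchings (A :\: [set d; u])|.
Proof.
move=> dA.
under eq_bigr => u /andP[uA edu] do rewrite -card_matchings_with //.
rewrite -sum1_card.
under [RHS]eq_bigr do rewrite -sum1dep_card big_mkcondr.
rewrite exchange_big /=; apply: eq_bigr => P; rewrite inE => /andP[pP eP].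
have dc : d \in cover P by rewrite (cover_partition pP).
have [u edu Bu] := edgeP (forall_inP eP _ (pblock_mem dc)) (etrans (mem_pblock P d) dc).
have uA : u \in A.
  rewrite -(cover_partition pP); apply/bigcupP; exists (pblock P d).
    exact: pblock_mem.
  by rewrite Bu !inE eqxx orbT.
rewrite (bigD1 u) ?uA ?edu //= -Bu pblock_mem // big1 // => v /andP[/andP[_ edv] vu].
case: ifP => // /def_pblock.
case/and3P: pP => _ tP _ => /(_ d tP); rewrite !inE eqxx => /(_ isT).
by rewrite Bu => /(pair_inj edu edv) uv; rewrite uv eqxx in vu.
Qed.

(** Meant for a whole row of triangles, each with a single possible partner. As no image under [f]
    lies in [U], removing one forced pair leaves the others intact, and induction on the size of [U]
    applies. *)
Lemma card_matchings_forced (A U : {set T}) (f : T -> T) :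
  U \subset A -> (forall u, u \in U -> f u \in A) ->
  {in U &, injective f} -> (forall u v, u \in U -> v \in U -> f u != v) ->
  (forall u v, u \in U -> v \in A -> e u v = (v == f u)) ->
  #|matchings A| = #|matchings (A :\: (U :|: f @: U))|.
Proof.
move: {2}#|U| (leqnn #|U|) => k; elim: k A U => [|k IH] A U cU UA fA f_inj fU eU.
  move: cU; rewrite leqn0 cards_eq0 => /eqP ->.
  by rewrite imset0 setU0 setD0.
have [->|[u uU]] := set_0Vmem U; first by rewrite imset0 setU0 setD0.
have uA := subsetP UA _ uU.
rewrite (card_matchings_expand uA) (big_pred1 (f u)); last first.
  move=> v /=; apply/andP/eqP => [[vA]|->]; first by rewrite eU // => /eqP.
  by rewrite fA // eU ?fA.
rewrite (IH _ (U :\ u)).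
- rewrite setDDl; congr #|pred_of_set (matchings (_ :\: _))|.
  rewrite -{3 4}(setD1K uU) imsetU1; apply/setP=> w.
  by rewrite !inE; case: (w == u); case: (w == f u); rewrite ?orbT.
- by rewrite -ltnS (leq_trans _ cU) // [ltnRHS](cardsD1 u) uU.
- apply/subsetP => v; rewrite !inE => /andP[vu vU].
  by rewrite (negbTE vu) eq_sym (negbTE (fU _ _ uU vU)) (subsetP UA).
- move=> v; rewrite !inE => /andP[vu vU]; rewrite fA // andbT negb_or fU //=.
  by apply: contra vu => /eqP /f_inj ->.
- by move=> v w; rewrite !inE => /andP[_ vU] /andP[_ wU]; apply: f_inj.
- by move=> v w; rewrite !inE => /andP[_ vU] /andP[_ wU]; apply: fU.
- by move=> v w; rewrite !inE => /andP[_ vU] /andP[_ wA]; apply: eU.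
Qed.

End PerfectMatchings.

(** * Lozenge tilings and lattice paths *)

Definition neighbours (t : triangle) : seq triangle :=
  let: (a, b, up) := t in
  if up then [:: (a, b, false); (a - 1, b, false); (a, b - 1, false)]
  else [:: (a, b, true); (a + 1, b, true); (a, b + 1, true)].

Lemma card_fset3I (K : choiceType) (a b c : K) (B : {fset K}) :
  uniq [:: a; b; c] ->
  #|` [fset a; b; c] `&` B| = ((a \in B) + (b \in B) + (c \in B))%N.
Proof.
move=> abc.
have -> : [fset a; b; c] `&` B = [fset w in [seq w <- [:: a; b; c] | w \in B]].
  by apply/fsetP => w; rewrite !inE mem_filter !inE andbC orbA.
by rewrite card_fseq undup_id ?filter_uniq // size_filter /= addn0 addnA.
Qed.

Lemma adjacentE (t u : triangle) : adjacent t u = (u \in neighbours t).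
Proof.
case: t u => [[a b] s] [[c d] r]; rewrite /adjacent.
have uU : uniq [:: (a, b); (a + 1, b); (a, b + 1)].
  by rewrite /= !inE !xpair_eqE; lia.
have uD : uniq [:: (a + 1, b); (a, b + 1); (a + 1, b + 1)].
  by rewrite /= !inE !xpair_eqE; lia.
by case: s; case: r; rewrite /vertices card_fset3I //= !inE !xpair_eqE /= {uU uD};
  repeat match goal with |- context [@eq_op _ ?y ?z] =>
    lazymatch type of y with nat => fail | bool => fail | _ => idtac end;
    case: (eqVneq y z) => ?; try (exfalso; lia)
    end.
Qed.

Lemma adjacent_sym : symmetric adjacent.
Proof. by move=> t u; rewrite /adjacent fsetIC. Qed.

Lemma adjacent_irr : irreflexive adjacent.
Proof. by case=> [[a b] []]; rewrite adjacentE !inE !xpair_eqE /= !andbF. Qed.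

Lemma neighbours_uniq (t : triangle) : uniq (neighbours t).
Proof. by case: t => [[a b] []]; rewrite /= !inE !xpair_eqE; lia. Qed.

Lemma all_fset3 (K : choiceType) (a b c : K) (P : pred K) :
  all P [fset a; b; c] = [&& P a, P b & P c].
Proof.
apply/allP/and3P => [h | [Pa Pb Pc] z]; last first.
  by rewrite !inE => /orP[/orP[]|] /eqP ->.
by split; apply: h; rewrite !inE eqxx ?orbT.
Qed.

Lemma up_in_hexagon (x n : nat) (a b : int) :
  ((a, b, true) \in hexagon x n n) =
  [&& - n%:Z <= a, a < x%:Z, 0 <= b, b < (n + n)%:Z, 0 <= a + b
    & a + b < x%:Z + n%:Z].
Proof.
by rewrite in_hexagonE /vertices all_fset3 /in_hexagon /=; lia.
Qed.

Lemma down_in_hexagon (x n : nat) (a b : int) :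
  ((a, b, false) \in hexagon x n n) =
  [&& - n%:Z <= a, a < x%:Z, 0 <= b, b < (n + n)%:Z, 0 <= a + b + 1
    & a + b + 1 < x%:Z + n%:Z].
Proof.
by rewrite in_hexagonE /vertices all_fset3 /in_hexagon /=; lia.
Qed.

Section TilingCount.
Variable R : {fset triangle}.

(** The finite type [R] stays fixed while triangles are removed by changing [Q], so no transport
    between different regions occurs. *)
Definition tiling_count (Q : pred triangle) : nat :=
  #|matchings (fun t u : R => adjacent (val t) (val u)) [set t : R | Q (val t)]|.

Lemma tiling_count_all : M R = tiling_count xpredT.
Proof.
by rewrite /M /tiling_count (_ : [set t : R | xpredT (val t)] = [set: R]).
Qed.

Lemma eq_tiling_count (Q Q' : pred triangle) :
  {in R, Q =1 Q'} -> tiling_count Q = tiling_count Q'.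
Proof.
move=> QQ'; congr #|pred_of_set (matchings _ _)|; apply/setP => t.
by rewrite !inE QQ' // (valP t).
Qed.

Lemma tiling_count0 (Q : pred triangle) :
  {in R, Q =1 xpred0} -> tiling_count Q = 1%N.
Proof.
move=> Q0; rewrite /tiling_count (_ : [set t : R | _] = set0).
  exact: card_matchings0.
by apply/setP => t; rewrite !inE Q0 // (valP t).
Qed.

Lemma tiling_count_expand (Q : pred triangle) (t : triangle) :
  t \in R -> Q t ->
  tiling_count Q = (\sum_(u <- neighbours t | (u \in R) && Q u)
    tiling_count (fun w => [&& Q w, w != t & w != u]))%N.
Proof.
move=> tR Qt; pose F u := tiling_count (fun w => [&& Q w, w != t & w != u]).
rewrite /tiling_count (@card_matchings_expand _ _ _ _ _ [` tR]); last first.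
- by rewrite inE.
- by move=> u; rewrite adjacent_irr.
- by move=> u w; rewrite adjacent_sym.
transitivity (\sum_(u : R | Q (val u) && (val u \in neighbours t)) F (val u))%N.
  apply: eq_big => [u|u _]; first by rewrite inE adjacentE.
  congr #|pred_of_set (matchings _ _)|; apply/setP => w.
  by rewrite !inE -!val_eqE /= negb_or andbC.
rewrite -(big_seq_fsetE _ _ (fun u => Q u && (u \in neighbours t)) F) /=.
rewrite -big_filter -[RHS]big_filter; apply: perm_big; apply: uniq_perm.
- by rewrite filter_uniq ?fset_uniq.
- by rewrite filter_uniq ?neighbours_uniq.
by move=> u; rewrite !mem_filter; case: (Q u) (u \in R) => [] []; rewrite ?andbF ?andbT.
Qed.

Lemma tiling_count_forced (Q U : pred triangle) (f : triangle -> triangle) :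
  {in R, forall u, U u -> Q u} ->
  {in R, forall u, U u -> (f u \in R) && Q (f u)} ->
  {in R &, forall u v, U u -> U v -> f u = f v -> u = v} ->
  {in R, forall u, U u -> ~~ U (f u)} ->
  {in R &, forall u v, U u -> Q v -> adjacent u v = (v == f u)} ->
  tiling_count Q =
  tiling_count (fun w => [&& Q w, ~~ U w & ~~ has (fun u => U u && (f u == w)) R]).
Proof.
move=> UQ fQ f_inj fU eU.
(* Outside [U] the image under [f] may leave [R]; the default value [u] only occurs there. *)
pose g (u : R) : R := insubd u (f (val u)).
have gE (u : R) : U (val u) -> val (g u) = f (val u).
  by move=> Uu; rewrite val_insubd (andP (fQ _ (valP u) Uu)).1.
rewrite /tiling_count (@card_matchings_forced _ _ _ _ _ [set t : R | U (val t)] g).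
- congr #|pred_of_set (matchings _ _)|; apply/setP => w; rewrite !inE.
  rewrite negb_or andbC; congr (_ && (_ && ~~ _)).
  apply/imsetP/hasP => [[u + ->]|[u uR /andP[Uu /eqP fu]]].
    by rewrite inE => Uu; exists (val u); rewrite ?(valP u) // Uu gE ?eqxx.
  by exists [` uR]; rewrite ?inE //; apply: val_inj; rewrite gE.
- by move=> u w; rewrite adjacent_sym.
- by move=> u; rewrite adjacent_irr.
- by apply/subsetP => u; rewrite !inE; apply: UQ; apply: valP.
- move=> u; rewrite !inE => Uu; rewrite gE //.
  by have /andP[] := fQ _ (valP u) Uu.
- move=> u v; rewrite !inE => Uu Uv guv; apply: val_inj.
  by apply: (f_inj _ _ (valP u) (valP v) Uu Uv); rewrite -(gE _ Uu) -(gE _ Uv) guv.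
- move=> u v; rewrite !inE => Uu Uv; apply/eqP => guv.
  by have := fU _ (valP u) Uu; rewrite -(gE _ Uu) guv Uv.
- move=> u v; rewrite !inE => Uu Qv.
  by rewrite (eU _ _ (valP u) (valP v)) // -val_eqE gE.
Qed.

End TilingCount.

(* Paths through the unit triangles from the horizontal unit segment with left
   end (a, q) down to the one with left end (j, 0), avoiding the segment at p. *)
Fixpoint path_count (p : point) (q : nat) (a j : int) : int :=
  if q is q'.+1 then
    if (a, q%:Z) == p then 0 else path_count p q' a j + path_count p q' (a + 1) j
  else (a == j)%:Z.

Lemma path_countS (p : point) (q : nat) (a j : int) :
  path_count p q.+1 a j =
  if (a, q.+1%:Z) == p then 0 else path_count p q a j + path_count p q (a + 1) j.
Proof. by []. Qed.

Lemma path_count_out (p : point) (q : nat) (a j : int) :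
  j < a \/ a + q%:Z < j -> path_count p q a j = 0.
Proof.
elim: q a => [|q IH] a h /=; first by rewrite (_ : a == j = false) //; lia.
by case: ifP => // _; rewrite !IH //; lia.
Qed.

(** * Tiling strip by strip: the count as a determinant of path counts *)

Section Strips.
Variables (n x : nat) (p : point).
Hypothesis p_height : 0 < p.2 < (n + n)%:Z.

Local Notation R := (hexagon x n n `\` vlozenge p).

Lemma upR (a b : int) :
  ((a, b, true) \in R) = ((a, b) != p) && ((a, b, true) \in hexagon x n n).
Proof.
by rewrite [p]surjective_pairing !inE /= !xpair_eqE /= andbF orbF andbT.
Qed.

Lemma downR (a b : int) :
  ((a, b, false) \in R) =
  ((a, b + 1) != p) && ((a, b, false) \in hexagon x n n).
Proof.
rewrite [p]surjective_pairing !inE /= !xpair_eqE /= andbF orFb andbT.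
by congr (~~ (_ && _) && _); lia.
Qed.

(* What is left to tile once all strips above strip q are tiled and the first k
   paths have crossed strip q; path i is at position c i, at height q if i < k
   and at height q + 1 otherwise. *)
Definition below (q k : nat) (c : nat -> int) (t : triangle) : bool :=
  let: (a, b, up) := t in
  (b < q%:Z) || ((b == q%:Z) &&
    (if up then ~~ [exists i : 'I_x, (i < k)%N && (c i == a)]
     else [exists i : 'I_x, (k <= i)%N && (c i == a)])).

(** The slack is for [i < k <= j]: path [i] has already gone down, possibly increasing its first
    coordinate by one, so it may have the same first coordinate as path [j], which is one level
    higher. *)
Definition admissible (q k : nat) (c : nat -> int) : Prop :=
  [/\ forall i j : nat, (i < j < x)%N -> c i < c j + ((i < k <= j)%N)%:Z,
      forall i : nat, (i < x)%N -> (i < k)%N -> (c i, q%:Z, true) \in R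
    & forall i : nat, (i < x)%N -> (k <= i)%N -> (c i, q%:Z, false) \in R].

Definition move_to (c : nat -> int) (k : nat) (v : int) : nat -> int :=
  fun i => if i == k then v else c i.

Definition path_mx (q k : nat) (c : nat -> int) : 'M[int]_x :=
  \matrix_(i, j) path_count p (if (i < k)%N then q else q.+1) (c i) j%:Z.

(** Row [k] is the sum of the rows for its two continuations, and the determinant is linear in that
    row. *)
Lemma det_path_mx_split (q k : nat) (c : nat -> int) :
  (k < x)%N -> (c k, q.+1%:Z) != p ->
  \det (path_mx q k c) =
  \det (path_mx q k.+1 (move_to c k (c k)))
  + \det (path_mx q k.+1 (move_to c k (c k + 1))).
Proof.
move=> kx ckp; pose k0 := Ordinal kx.
have other v : row' k0 (path_mx q k.+1 (move_to c k v)) = row' k0 (path_mx q k c).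
  apply/matrixP => i j; rewrite !mxE /move_to.
  have ik : (lift k0 i : nat) != k.
    by have := neq_lift k0 i; rewrite eq_sym -val_eqE.
  by rewrite (negbTE ik) ltnS leq_eqVlt (negbTE ik).
rewrite (@determinant_multilinear _ _ _ _ _ k0 1 1 _ (other (c k)) (other (c k + 1))).
  by rewrite !mul1r.
apply/rowP => j; rewrite !mxE /move_to -[nat_of_ord k0]/k eqxx ltnn ltnSn !mul1r.
by rewrite path_countS (negbTE ckp).
Qed.

Lemma det_path_mx_out (q k : nat) (c : nat -> int) (v : int) :
  (k < x)%N -> (forall j, (j < x)%N -> path_count p q v j%:Z = 0) ->
  \det (path_mx q k.+1 (move_to c k v)) = 0.
Proof.
move=> kx v0; rewrite (expand_det_row _ (Ordinal kx)) big1 // => j _.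
by rewrite !mxE /move_to /= eqxx ltnSn v0 ?mul0r.
Qed.

Lemma det_path_mx_collision (q k i : nat) (c : nat -> int) :
  (i < k < x)%N -> \det (path_mx q k.+1 (move_to c k (c i))) = 0.
Proof.
case/andP=> ik kx; have ix := ltn_trans ik kx.
apply: (@determinant_alternate _ _ _ (Ordinal ix) (Ordinal kx)).
  by rewrite -val_eqE /= ltn_eqF.
move=> j; rewrite !mxE /move_to /= eqxx ltnSn (ltn_eqF ik).
by rewrite ltnS (ltnW ik).
Qed.

Lemma below_move (q k : nat) (c : nat -> int) (v : int) (t : triangle) :
  (k < x)%N -> (forall i : nat, (k < i < x)%N -> c k < c i) ->
  [&& below q k c t, t != (c k, q%:Z, false) & t != (v, q%:Z, true)]
  = below q k.+1 (move_to c k v) t.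
Proof.
case: t => [[a b] up] kx ck; rewrite /below !xpair_eqE.
have [->|bq] := eqVneq b q%:Z; last first.
  by rewrite !andbF /= !orbF !andbT.
rewrite ltxx !orFb !andTb !andbT; case: up; rewrite ?andbF ?andbT ?andTb.
  rewrite -negb_or; congr (~~ _); apply/orP/existsP.
    case=> [/existsP[i /andP[ik cia]]|/eqP ->].
      by exists i; rewrite /move_to ltnS (ltnW ik) (ltn_eqF ik).
    by exists (Ordinal kx); rewrite /move_to /= ltnSn !eqxx.
  case=> i; rewrite /move_to ltnS leq_eqVlt.
  case: eqP => [_ /eqP <-|_ /= ik]; first by right.
  by left; apply/existsP; exists i.
apply/andP/existsP.
  case=> /existsP[i /andP[ki cia]] ack; exists i; rewrite /move_to.
  move: ki; rewrite leq_eqVlt; case: eqP => [ki|_ /= ki].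
    by rewrite -(eqP cia) ki eqxx in ack.
  by rewrite ki (gtn_eqF ki).
case=> i /andP[ki]; rewrite /move_to (gtn_eqF ki) => cia.
split; first by apply/existsP; exists i; rewrite (ltnW ki).
by have := ck i; rewrite ki ltn_ord => /(_ isT); rewrite -(eqP cia); lia.
Qed.

Definition free_up (q k : nat) (c : nat -> int) (v : int) : bool :=
  ((v, q%:Z, true) \in R) && ~~ [exists i : 'I_x, (i < k)%N && (c i == v)].

Lemma tiling_count_move (q k : nat) (c : nat -> int) :
  (k < x)%N -> admissible q k c ->
  let F v := (if free_up q k c v
              then tiling_count R (below q k.+1 (move_to c k v)) else 0)%N in
  tiling_count R (below q k c) = (F (c k) + F (c k + 1)%R)%N.
Proof.
move=> kx [c_inc _ c_down] F.
have ck (i : nat) : (k < i < x)%N -> c k < c i.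
  by move=> /c_inc; rewrite ltnn /= addr0.
rewrite (tiling_count_expand (c_down _ kx (leqnn _))); last first.
  rewrite /below ltxx eqxx /=; apply/existsP; exists (Ordinal kx).
  by rewrite /= leqnn eqxx.
have upE v : ((v, q%:Z, true) \in R) && below q k c (v, q%:Z, true) = free_up q k c v.
  by rewrite /below ltxx eqxx.
rewrite !big_cons big_nil !upE.
have -> : below q k c (c k, q%:Z + 1, true) = false.
  by rewrite /below; lia.
rewrite andbF.
have E v : tiling_count R (fun w => [&& below q k c w, w != (c k, q%:Z, false)
      & w != (v, q%:Z, true)]) = tiling_count R (below q k.+1 (move_to c k v)).
  by apply: eq_tiling_count => t _; apply: below_move.
by rewrite !E /F; case: ifP => _; case: ifP => _; rewrite ?addn0.
Qed.

Lemma admissible_move (q k : nat) (c : nat -> int) (v : int) :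
  (k < x)%N -> admissible q k c -> free_up q k c v -> c k <= v <= c k + 1 ->
  admissible q k.+1 (move_to c k v).
Proof.
move=> kx [c_inc c_up c_down] /andP[vR /existsPn vN] ckv; split.
- move=> i j ijx; have ij := c_inc i j ijx; rewrite /move_to.
  have [ik|ik] := eqVneq i k; have [jk|jk] := eqVneq j k.
  + by lia.
  + by move: ij; rewrite ik; lia.
  + have ix : (i < x)%N by lia.
    have := vN (Ordinal ix); rewrite /= negb_and; move: ij; rewrite jk; lia.
  + by move: ij; lia.
- move=> i ix; rewrite /move_to ltnS leq_eqVlt.
  by case: eqP => [_ _|_ /= ik]; [exact: vR | exact: c_up].
- by move=> i ix ki; rewrite /move_to (gtn_eqF ki); apply: c_down => //; apply: ltnW.
Qed.

(** An up triangle outside the hexagon or in the deleted lozenge gives a zero row; one already taken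
    by an earlier path gives two equal rows. *)
Lemma free_up_det (q k : nat) (c : nat -> int) (v : int) :
  (k < x)%N -> (q < n + n)%N -> admissible q k c -> c k <= v <= c k + 1 ->
  ~~ free_up q k c v -> \det (path_mx q k.+1 (move_to c k v)) = 0.
Proof.
move=> kx qn [_ _ c_down] ckv; rewrite negb_and negbK => /orP[vR|].
  apply: det_path_mx_out => // j jx.
  have := c_down _ kx (leqnn _); rewrite downR => /andP[_].
  rewrite down_in_hexagon => ckR; move: vR; rewrite upR negb_and negbK.
  case/orP => [/eqP vp|].
    (* At height 0 [path_count] does not test for [p], but [p] lies strictly above the bottom
       side. *)
    case: q vp {qn ckR c_down} => [|q] vp; first by move: p_height; rewrite -vp /=; lia.
    by rewrite /= vp eqxx.
  by rewrite up_in_hexagon => vR; apply: path_count_out; lia.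
case/existsP => i /andP[ik /eqP <-]; apply: det_path_mx_collision.
by rewrite ik.
Qed.

(** At the bottom side this forces the [x] paths to end on the [x] unit segments in order, so that
    the last path matrix is the identity. *)
Lemma increasing_id (c : nat -> int) :
  (forall i j : nat, (i < j < x)%N -> c i < c j) ->
  (forall i : nat, (i < x)%N -> 0 <= c i < x%:Z) ->
  forall i : nat, (i < x)%N -> c i = i%:Z.
Proof.
move=> c_inc c_in i ix.
have lb : i%:Z <= c i.
  elim: i ix => [|i IH] ix; first by have /andP[] := c_in 0%N ix.
  have := IH (ltnW ix); have := c_inc i i.+1; rewrite ltnSn ix => /(_ isT).
  by lia.
have ub k : (i + k < x)%N -> c i + k%:Z <= c (i + k)%N.
  elim: k => [|k IH] kx; first by rewrite addn0 addr0.
  have := c_inc (i + k)%N (i + k.+1)%N.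
  have -> : (i + k < i + k.+1 < x)%N by lia.
  have k'x : (i + k < x)%N by lia.
  by move=> /(_ isT); have := IH k'x; lia.
have [k kE] : exists k, x = (i + k).+1 by exists (x - i.+1)%N; lia.
have kx : (i + k < x)%N by rewrite kE.
by have := ub _ kx; have := c_in _ kx; lia.
Qed.

(** When path [k] crosses the strip, the count and the determinant split into the same two cases;
    equality therefore passes back from the state in which all paths have crossed. *)
Lemma tiling_count_strip (q k : nat) (c : nat -> int) :
  (q < n + n)%N ->
  (forall c', admissible q x c' ->
     (tiling_count R (below q x c'))%:Z = \det (path_mx q x c')) ->
  (k <= x)%N -> admissible q k c ->
  (tiling_count R (below q k c))%:Z = \det (path_mx q k c).
Proof.
move=> qn full; move: {2}(x - k)%N (erefl (x - k)%N) => r.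
elim: r k c => [|r IHr] k c rE kx adm.
  have kE : k = x by lia.
  by rewrite kE; apply: full; rewrite -kE.
have {}kx : (k < x)%N by lia.
have ckp : (c k, q.+1%:Z) != p.
  case: (adm) => _ _ /(_ _ kx (leqnn _)); rewrite downR => /andP[].
  by rewrite -[q.+1]addn1 PoszD.
rewrite (tiling_count_move kx adm) det_path_mx_split // PoszD.
congr (_ + _); case: ifPn => fu.
- by apply: IHr => //; [lia | apply: admissible_move => //; lia].
- by rewrite (@free_up_det _ _ _ _ kx qn adm) //; lia.
- by apply: IHr => //; [lia | apply: admissible_move => //; lia].
- by rewrite (@free_up_det _ _ _ _ kx qn adm) //; lia.
Qed.

Lemma up_below (a : int) (q : nat) : (q.+1 < n + n)%N ->
  ((a, q.+1%:Z, true) \in R) = ((a, q%:Z, false) \in R).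
Proof.
move=> qn; rewrite upR downR up_in_hexagon down_in_hexagon -[q.+1]addn1 PoszD.
by congr (_ && _); lia.
Qed.

(** When all paths have crossed strip [q.+1], its down triangles are used up. Each up triangle still
    free must be joined to the down triangle below it: these are the vertical lozenges. What remains
    is strip [q], entered by the same paths. *)
Lemma tiling_count_next (q : nat) (c : nat -> int) : (q.+1 < n + n)%N ->
  tiling_count R (below q.+1 x c) = tiling_count R (below q 0 c).
Proof.
move=> qn.
pose U (t : triangle) := [&& t.1.2 == q.+1%:Z, t.2 & below q.+1 x c t].
pose f (t : triangle) : triangle := (t.1.1, t.1.2 - 1, false).
have UE (a b : int) (up : bool) : U (a, b, up) =
    [&& b == q.+1%:Z, up & ~~ [exists i : 'I_x, c i == a]].
  rewrite /U /=; case: eqP => //= ->; case: up => //=; rewrite ltxx ?eqxx /=.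
  by congr (~~ _); apply: eq_existsb => i; rewrite ltn_ord.
have belowE (a b : int) (up : bool) : below q.+1 x c (a, b, up) =
    (b <= q%:Z) || U (a, b, up).
  rewrite UE /below (_ : (b < q.+1%:Z) = (b <= q%:Z)); last by lia.
  congr (_ || (_ && _)); case: up => /=.
    by congr (~~ _); apply: eq_existsb => i; rewrite ltn_ord.
  by apply/existsP => -[i]; rewrite leqNgt ltn_ord.
rewrite (@tiling_count_forced _ _ U f).
- apply: eq_tiling_count => -[[a b] up] tR; rewrite belowE.
  have [Ut|UNt] := boolP (U _); first by move: Ut; rewrite UE /below /=; lia.
  rewrite orbF /=.
  have [bq|bq] := ltP b q%:Z; last have [bE|bNq] := eqVneq b q%:Z.
  + rewrite (ltW bq) /=; apply/hasPn => -[[a' b'] up'] _.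
    by rewrite UE /f /= !xpair_eqE; lia.
  + rewrite bE lexx /=; case: up tR {UNt} => tR.
      rewrite (_ : [exists i : 'I_x, _] = false); last by apply/existsP => -[i].
      by apply/hasPn => -[[a' b'] up'] _; rewrite /f /= !xpair_eqE !andbF.
    apply/hasPn/existsP => [noU|[i ci] [[a' b'] up'] _].
      apply/existsP; apply: contraT => aN.
      have := noU (a, q.+1%:Z, true); rewrite up_below // -bE => /(_ tR).
      by rewrite UE eqxx aN /f /= !xpair_eqE eqxx /=; lia.
    rewrite UE /f /= !xpair_eqE; apply/negP => /andP[/and3P[_ _ /existsPn aN] a'a].
    have {}a'a : a' = a by lia.
    by have := aN i; rewrite a'a ci.
  + by rewrite /below; lia.
- by move=> [[a b] up] _ Ut; rewrite belowE Ut orbT.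
- move=> [[a b] up] tR; rewrite UE => /and3P[/eqP bE upE _].
  move: tR; rewrite bE upE /f /= (_ : q.+1%:Z - 1 = q%:Z) ?up_below; try lia.
  by move=> ->; rewrite /below; lia.
- move=> [[a b] up] [[a' b'] up'] _ _; rewrite !UE /f /=.
  by move=> /and3P[/eqP -> -> _] /and3P[/eqP -> -> _] [->].
- by move=> [[a b] up] _ _; rewrite UE andbF.
- move=> [[a b] up] [[a' b'] up'] _ _; rewrite UE belowE UE.
  move=> /and3P[/eqP -> -> _]; rewrite adjacentE /f !inE !xpair_eqE /=.
  by case: up'; lia.
Qed.

Lemma tiling_count_det (q k : nat) (c : nat -> int) :
  (q < n + n)%N -> (k <= x)%N -> admissible q k c ->
  (tiling_count R (below q k c))%:Z = \det (path_mx q k c).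
Proof.
elim: q k c => [|q IHq] k c qn kx adm; apply: tiling_count_strip => // {kx adm}c.
  case=> c_inc c_up _.
  have cE (i : nat) : (i < x)%N -> c i = i%:Z.
    apply: increasing_id => [i' j ij|i' ix].
      have := c_inc _ _ ij; have /andP[_ jx] := ij.
      by rewrite [(x <= j)%N]leqNgt jx andbF addr0.
    by have := c_up _ ix ix; rewrite upR up_in_hexagon; lia.
  rewrite tiling_count0; last first.
    move=> [[a b] up] tR; apply/negbTE/negP; rewrite /below; case: up tR.
      rewrite upR up_in_hexagon => /andP[_ tH] /orP[|/andP[b0 /existsPn]]; first by lia.
      have ax : (`|a| < x)%N by lia.
      by move=> /(_ (Ordinal ax)); rewrite /= ax cE //; lia.
    rewrite downR down_in_hexagon => /andP[_ tH] /orP[|/andP[_ /existsP[i]]]; first by lia.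
    by rewrite leqNgt ltn_ord.
  rewrite (_ : path_mx 0 x c = 1%:M) ?det1 //.
  by apply/matrixP => i j; rewrite !mxE ltn_ord /= cE // eqz_nat val_eqE; case: eqP.
case=> c_inc c_up _; rewrite tiling_count_next //.
rewrite (IHq 0%N) //; first last.
- split=> // [i j ij|i ix _].
    have := c_inc _ _ ij; have /andP[_ jx] := ij.
    by rewrite [(x <= j)%N]leqNgt jx andbF.
  by rewrite -up_below // c_up.
- by apply: ltnW.
by congr (\det _); apply/matrixP => i j; rewrite !mxE ltn_ord.
Qed.

Lemma tilings_det :
  (M R)%:Z = \det (\matrix_(i < x, j < x)
    path_count p (n + n) (i%:Z - n%:Z) j%:Z).
Proof.
have nn : (0 < n + n)%N by lia.
(* Left ends of the unit segments of the top side, where the paths start. *)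
pose c (i : nat) : int := i%:Z - n%:Z.
have nE : ((n + n).-1.+1 = n + n)%N by rewrite prednK.
rewrite tiling_count_all.
rewrite (@eq_tiling_count _ _ (below (n + n).-1 0 c)).
  rewrite tiling_count_det //; first last.
  - split=> // [i j ij|i ix _]; first by rewrite /c; lia.
    rewrite downR down_in_hexagon; apply/andP; split; last by rewrite /c; lia.
    by apply/eqP => pE; move: p_height; rewrite -pE /=; lia.
  - by rewrite prednK.
  by congr (\det _); apply/matrixP => i j; rewrite !mxE ltn0 nE.
move=> [[a b] up] tR; apply/esym; rewrite /below; case: up tR.
  rewrite upR up_in_hexagon => /andP[_ tH]; have [|bn] := ltP; first by [].
  rewrite (_ : (b == _) = true) /=; last by lia.
  by apply/existsPn.
rewrite downR down_in_hexagon => /andP[_ tH]; have [|bn] := ltP; first by [].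
rewrite (_ : (b == _) = true) /=; last by lia.
have ax : (absz (a + n%:Z)%R < x)%N by lia.
by apply/existsP; exists (Ordinal ax); rewrite /c /=; lia.
Qed.
End Strips.

(** * Representers for a Toeplitz form *)

Definition binz (q : nat) (z : int) : nat := if z is Posz k then 'C(q, k) else 0.

Lemma binz0 (z : int) : binz 0 z = (z == 0).
Proof. by case: z => [[|k]|k]. Qed.

Lemma binzS (q : nat) (z : int) : binz q.+1 z = (binz q z + binz q (z - 1))%N.
Proof.
case: z => [[|k]|k] //; first by rewrite /= !bin0.
by rewrite (_ : Posz k.+1 - 1 = k) ?[LHS]binS //; lia.
Qed.

Lemma binz_sub (q : nat) (z : int) : binz q (q%:Z - z) = binz q z.
Proof.
case: z => k.
  have [kq|qk] := leqP k q; first by rewrite subzn //= bin_sub.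
  rewrite /= bin_small // (_ : q%:Z - k%:Z = Negz (k - q.+1)) //.
  by rewrite NegzE; lia.
rewrite (_ : q%:Z - Negz k = (q + k.+1)%N); last by rewrite NegzE; lia.
by rewrite /= bin_small //; lia.
Qed.

(** Vectors are encoded as polynomials: this is the scalar product of the coefficients of [f] with
    the row C(t, s - j). Lengthening the row becomes multiplication by [1 + 'X], and shifting it
    multiplication by ['X]. *)
Definition coef_at (t s : nat) (f : {poly rat}) : rat := ((1 + 'X) ^+ t * f)`_s.

Lemma coef_atD t s f g : coef_at t s (f + g) = coef_at t s f + coef_at t s g.
Proof. by rewrite /coef_at mulrDr coefD. Qed.

Lemma coef_atZ t s a f : coef_at t s (a *: f) = a * coef_at t s f.
Proof. by rewrite /coef_at -scalerAr coefZ. Qed.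

Lemma coef_atB t s f g : coef_at t s (f - g) = coef_at t s f - coef_at t s g.
Proof. by rewrite /coef_at mulrBr coefB. Qed.

Lemma coef_at_mul t s f : coef_at t s ((1 + 'X) * f) = coef_at t.+1 s f.
Proof. by rewrite /coef_at exprSr mulrA. Qed.

Lemma coef_at_mulX t s f : coef_at t s.+1 ('X * f) = coef_at t s f.
Proof. by rewrite /coef_at mulrCA coefXM. Qed.

Lemma coef_atS t s f : coef_at t.+1 s.+1 f = coef_at t s.+1 f + coef_at t s f.
Proof. by rewrite -coef_at_mul mulrDl mul1r coef_atD coef_at_mulX. Qed.

Lemma coef_atSS t s f : coef_at t.+2 s.+2 f =
  coef_at t s.+2 f + coef_at t s.+1 f + (coef_at t s.+1 f + coef_at t s f).
Proof. by rewrite !coef_atS. Qed.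

Lemma coef_at_Xn t s j : coef_at t s 'X^j = (binz t (s%:Z - j%:Z))%:R.
Proof.
elim: t s j => [|t IH] s j.
  rewrite /coef_at expr0 mul1r coefXn binz0; congr (_ %:R).
  by congr (nat_of_bool _); lia.
rewrite -coef_at_mul mulrDl mul1r -exprS coef_atD !IH -natrD binzS.
by congr ((_ + binz _ _)%:R); lia.
Qed.

Lemma coef_at_expand t s k (f : {poly rat}) : (size f <= k)%N ->
  coef_at t s f = \sum_(i < k) f`_i * coef_at t s 'X^i.
Proof.
move=> fk; rewrite {1}(_ : f = \sum_(i < k) f`_i *: 'X^i).
  rewrite /coef_at mulr_sumr coef_sum; apply: eq_bigr => i _.
  by rewrite -scalerAr coefZ.
apply/polyP => j; rewrite coef_sum.
under eq_bigr do rewrite coefZ coefXn.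
have [jk|kj] := ltnP j k.
  rewrite (bigD1 (Ordinal jk)) //= eqxx mulr1 big1 ?addr0 // => i ij.
  by rewrite (_ : (j == i) = false) ?mulr0 // eq_sym; apply/negbTE.
rewrite nth_default ?(leq_trans fk) // big1 // => i _.
by rewrite (_ : (j == i) = false) ?mulr0 // gtn_eqF // (leq_trans (ltn_ord i)).
Qed.

Lemma toeplitz_sym n i j :
  coef_at (n + n) (n + i) 'X^j = coef_at (n + n) (n + j) 'X^i.
Proof.
rewrite !coef_at_Xn -binz_sub; congr ((binz _ _)%:R).
by rewrite !PoszD; ring.
Qed.

Section Representers.
Variables (n' d : nat).
Local Notation n := n'.+1.
(** [al] and [be] are the first and last columns of A^-1. [G1] is the monic orthogonal polynomial of
    degree d + 1 for the Toeplitz form, and [G0] its reversed counterpart with constant term 1. The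
    last two change end coefficients without disturbing the equations, the first two change a single
    equation. *)
Variables (al be G0 G1 : {poly rat}).
Hypotheses (al_size : (size al <= d.+1)%N) (be_size : (size be <= d.+1)%N).
Hypotheses (G0_size : (size G0 <= d.+2)%N) (G1_size : (size G1 <= d.+2)%N).
Hypothesis al_eq : forall j, (j <= d)%N -> coef_at (n + n) (n + j) al = (j == 0%N)%:R.
Hypothesis be_eq : forall j, (j <= d)%N -> coef_at (n + n) (n + j) be = (j == d)%:R.
Hypothesis G0_0 : G0`_0 = 1.
Hypothesis G1_d : G1`_d.+1 = 1.
Hypothesis G0_eq : forall j, (j <= d)%N -> coef_at (n + n) (n + j).+1 G0 = 0.
Hypothesis G1_eq : forall j, (j <= d)%N -> coef_at (n + n) (n + j) G1 = 0.

(* The coefficients of y are those of A^-1 u, where u_j = C(t, s - j). *)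
Definition represents (t s : nat) (y : {poly rat}) : Prop :=
  (size y <= d.+1)%N /\
  forall j, (j <= d)%N -> coef_at (n + n) (n + j) y = coef_at t s 'X^j.

(** By the symmetry of A, u^T f = (A y)^T f = y^T A f. *)
Lemma represents_pair t s y (f : {poly rat}) : represents t s y -> (size f <= d.+1)%N ->
  coef_at t s f = \sum_(k < d.+1) y`_k * coef_at (n + n) (n + k) f.
Proof.
move=> [sy yE] sf; rewrite (coef_at_expand _ _ sf).
under eq_bigr => j _ do rewrite -yE -1?ltnS // (coef_at_expand _ _ sy) mulr_sumr.
rewrite exchange_big; apply: eq_bigr => k _.
rewrite (coef_at_expand _ _ sf) mulr_sumr; apply: eq_bigr => j _.
by rewrite toeplitz_sym mulrCA.
Qed.

Lemma represents_al t s y : represents t s y -> coef_at t s al = y`_0.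
Proof.
move=> yR; rewrite (represents_pair yR al_size) big_ord_recl al_eq // mulr1.
by rewrite big1 ?addr0 // => k _; rewrite al_eq ?mulr0 // -ltnS ltn_ord.
Qed.

Lemma represents_be t s y : represents t s y -> coef_at t s be = y`_d.
Proof.
move=> yR; rewrite (represents_pair yR be_size) big_ord_recr be_eq //= eqxx mulr1.
by rewrite big1 ?add0r // => k _; rewrite be_eq 1?ltnW // ltn_eqF ?mulr0.
Qed.

(** The right-hand side is the defect of the Toeplitz equation of [y] in row -1, just before the
    rows where it holds; n - 1 is [n']. *)
Lemma represents_G0 t s y : represents t s y ->
  coef_at t s.+1 G0 = coef_at t s.+1 1 - coef_at (n + n) n' y.
Proof.
move=> yR; pose f := \poly_(i < d.+1) G0`_i.+1.
have G0E : G0 = 1 + 'X * f.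
  apply/polyP => -[|i]; rewrite coefD coefXM ?coef1 /= ?addr0 // add0r coef_poly.
  by case: ltnP => // di; rewrite nth_default // (leq_trans G0_size).
have fE k : (k <= d)%N -> coef_at (n + n) (n + k) f = - coef_at (n + n) n' 'X^k.
  move=> kd; have := G0_eq kd; rewrite {1}G0E coef_atD coef_at_mulX.
  have -> : coef_at (n + n) (n + k).+1 1 = coef_at (n + n) n' 'X^k.
    rewrite -(expr0 'X) !coef_at_Xn -binz_sub; congr ((binz _ _)%:R); lia.
  by move/eqP; rewrite addrC addr_eq0 => /eqP.
rewrite {1}G0E coef_atD coef_at_mulX (represents_pair yR) ?size_poly //.
congr (_ + _); rewrite (coef_at_expand _ _ yR.1) -sumrN; apply: eq_bigr => k _.
by rewrite fE -1?ltnS // mulrN.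
Qed.

(** The corresponding defect in row d + 1, just beyond the other end. *)
Lemma represents_G1 t s y : represents t s y ->
  coef_at t s G1 = coef_at t s 'X^(d.+1) - coef_at (n + n) (n + d.+1) y.
Proof.
move=> yR; pose f := \poly_(i < d.+1) G1`_i.
have G1E : G1 = f + 'X^(d.+1).
  apply/polyP => i; rewrite coefD coefXn coef_poly.
  case: (ltngtP i d.+1) => [|di|->]; rewrite ?addr0 ?add0r //.
  by rewrite nth_default // (leq_trans G1_size).
have fE k : (k <= d)%N ->
    coef_at (n + n) (n + k) f = - coef_at (n + n) (n + d.+1) 'X^k.
  move=> kd; have := G1_eq kd; rewrite {1}G1E coef_atD toeplitz_sym.
  by move/eqP; rewrite addr_eq0 => /eqP.
rewrite {1}G1E coef_atD addrC (@represents_pair _ _ _ f yR (size_poly _ _)).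
congr (_ + _); rewrite (coef_at_expand _ _ yR.1) -sumrN; apply: eq_bigr => k _.
by rewrite fE -1?ltnS // mulrN.
Qed.

(** Multiplying [y] by [1 + 'X] creates a coefficient of degree d + 1, which [G1] removes, and an
    error in row 0 equal to the defect of [y] in row -1, which [al] repairs. *)
Lemma represents_right t s y : represents t s y ->
  exists2 y', represents t.+1 s.+1 y' &
  forall t' s', coef_at t' s' y' =
    coef_at t'.+1 s' y - coef_at t s be * coef_at t' s' G1
    + coef_at t s.+1 G0 * coef_at t' s' al.
Proof.
move=> yR; have [sy yE] := yR.
exists ((1 + 'X) * y - coef_at t s be *: G1 + coef_at t s.+1 G0 *: al); last first.
  by move=> t' s'; rewrite coef_atD coef_atB !coef_atZ coef_at_mul.
split.
  apply/leq_sizeP => j dj; rewrite coefD coefB !coefZ mulrDl mul1r coefD coefXM.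
  rewrite [al`_j]nth_default ?(leq_trans al_size) // mulr0 addr0.
  rewrite [y`_j]nth_default ?(leq_trans sy) // add0r.
  case: j dj => // j dj /=; rewrite (represents_be yR); move: dj; rewrite ltnS leq_eqVlt.
  case/orP => [/eqP <-|dj]; first by rewrite G1_d mulr1 subrr.
  rewrite [y`_j]nth_default ?(leq_trans sy) // [G1`_j.+1]nth_default ?mulr0 ?subr0 //.
  exact: leq_trans G1_size _.
move=> j jd; rewrite coef_atD coef_atB !coef_atZ G1_eq // mulr0 subr0 al_eq //.
rewrite mulrDl mul1r coef_atD yE // coef_atS (represents_G0 yR).
case: j jd => [|j] jd.
  by rewrite addn0 coef_at_mulX mulr1 expr0; ring.
by rewrite [(n + j.+1)%N]addnS coef_at_mulX (yE j) 1?ltnW // mulr0 addr0 exprS coef_at_mulX addrC.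
Qed.

(** Here [y] is multiplied by (1 + z)^2 / z. [G0] removes the constant term, which makes the
    division by ['X] possible, and ['X * G1] removes the term of degree d + 2. Then [al] and [be]
    repair rows 0 and d, with the two defects as factors. *)
Lemma represents_down t s y : represents t s y ->
  exists2 y', represents t.+2 s.+1 y' &
  forall t' s', coef_at t' s' y' =
    coef_at t'.+2 s'.+1 y
    - coef_at t s al * coef_at t' s'.+1 G0 - coef_at t s be * coef_at t' s' G1
    + coef_at t s.+1 G0 * coef_at t' s' al + coef_at t s G1 * coef_at t' s' be.
Proof.
move=> yR; have [sy yE] := yR.
pose r := (1 + 'X) * ((1 + 'X) * y) - coef_at t s al *: G0
          - coef_at t s be *: ('X * G1).
pose w := \poly_(i < d.+1) r`_i.+1.
have rE : r = 'X * w.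
  apply/polyP => i; rewrite coefXM; case: i => [|i] /=.
    rewrite /r !coefB !coefZ !mulrDl !mul1r !mulrDr !coefD !coefXM /= G0_0 mulr1.
    by rewrite (represents_al yR); ring.
  rewrite coef_poly; case: ltnP => // di.
  rewrite /r !coefB !coefZ !mulrDl !mul1r !mulrDr !coefD !coefXM /=.
  rewrite [y`_i.+1]nth_default ?(leq_trans sy) ?leqW //.
  rewrite [y`_i]nth_default ?(leq_trans sy) //.
  rewrite [G0`_i.+1]nth_default ?(leq_trans G0_size) // (represents_be yR).
  case: i di => // i di; rewrite /= ?addr0 ?add0r mulr0 subr0.
  move: di; rewrite ltnS leq_eqVlt => /orP[/eqP <-|di].
    by rewrite G1_d mulr1 subrr.
  rewrite [y`_i]nth_default ?(leq_trans sy) // [G1`_i.+1]nth_default ?mulr0 ?subr0 //.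
  by rewrite (leq_trans G1_size).
have wE t' s' : coef_at t' s' w = coef_at t'.+2 s'.+1 y
    - coef_at t s al * coef_at t' s'.+1 G0 - coef_at t s be * coef_at t' s' G1.
  by rewrite -coef_at_mulX -rE /r !coef_atB !coef_atZ !coef_at_mul coef_at_mulX.
exists (w + coef_at t s.+1 G0 *: al + coef_at t s G1 *: be); last first.
  by move=> t' s'; rewrite !coef_atD !coef_atZ wE.
split.
  apply/leq_sizeP => j dj; rewrite !coefD !coefZ.
  by rewrite !nth_default ?mulr0 ?addr0 // (leq_trans _ dj) // size_poly.
move=> j jd; rewrite !coef_atD !coef_atZ wE G0_eq // G1_eq // al_eq // be_eq //.
rewrite !mulr0 !subr0.
have -> : coef_at (n + n).+2 (n + j).+1 y = coef_at (n + n) (n + j).+1 y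
    + coef_at t s 'X^j + (coef_at t s 'X^j + coef_at (n + n) (n' + j) y).
  by rewrite -yE // addSn coef_atSS.
have -> : coef_at t.+2 s.+1 'X^j = coef_at t s 'X^j + coef_at t s 'X^j
    + coef_at t s.+1 'X^j + coef_at t s 'X^(j.+1).
  rewrite !coef_at_Xn !binzS !natrD.
  have -> : s.+1%:Z - j%:Z - 1 = s%:Z - j%:Z by lia.
  have -> : s%:Z - j.+1%:Z = s%:Z - j%:Z - 1 by lia.
  by ring.
have -> : coef_at t s.+1 G0 * (j == 0%N)%:R =
    coef_at t s.+1 'X^j - coef_at (n + n) (n' + j) y.
  case: j jd => [|j] jd; first by rewrite addn0 mulr1 (represents_G0 yR) expr0.
  by rewrite mulr0 -[(n' + j.+1)%N]addSnnS yE 1?ltnW // exprS coef_at_mulX subrr.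
have -> : coef_at t s G1 * (j == d)%:R =
    coef_at t s 'X^(j.+1) - coef_at (n + n) (n + j).+1 y.
  move: jd; rewrite leq_eqVlt; case: eqP => [-> _|_ /= jd].
    by rewrite mulr1 (represents_G1 yR) [(n + d.+1)%N]addnS.
  by rewrite mulr0 -[(n + j).+1]addnS yE // subrr.
by ring.
Qed.

End Representers.

(** * Explicit kernel vectors *)

(** Finite differences of order [d] kill polynomials of lower degree. In a factor c + e i the part
    with i is absorbed by i C(d + 1, i) = (d + 1) C(d, i - 1), which lowers the order and shifts the
    other factors. *)
Lemma fdiff_prod0 (s : seq (rat * rat)) (d : nat) : (size s < d)%N ->
  \sum_(i < d.+1) (-1) ^+ i * 'C(d, i)%:R * \prod_(c <- s) (c.1 + c.2 * i%:R) = 0 :> rat.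
Proof.
move: {2}(size s) (erefl (size s)) => k; elim: k s d => [|k IH] [|[c e] s] // d.
  move=> _ sd; transitivity ((1 - 1 : rat) ^+ d); last by rewrite subrr expr0n gtn_eqF.
  by rewrite exprDn; apply: eq_bigr => i _; rewrite big_nil expr1n mul1r mulr1 mulr_natr.
move=> /= [sk] sd.
case: d sd => // d sd.
have sd' : (size s < d.+1)%N by apply: ltnW.
transitivity (c * \sum_(i < d.+2) (-1) ^+ i * 'C(d.+1, i)%:R
      * \prod_(c <- s) (c.1 + c.2 * i%:R)
    + \sum_(i < d.+2) (-1) ^+ i * ('C(d.+1, i)%:R * i%:R) * e
      * \prod_(c <- s) (c.1 + c.2 * i%:R)).
  rewrite mulr_sumr -big_split; apply: eq_bigr => i _.
  by rewrite big_cons /=; ring.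
rewrite (IH _ _ sk sd') mulr0 add0r big_ord_recl !(mulr0, mul0r) add0r.
transitivity (- (e * d.+1%:R) * \sum_(i < d.+1) (-1) ^+ i * 'C(d, i)%:R
   * \prod_(c <- [seq (c.1 + c.2, c.2) | c <- s]) (c.1 + c.2 * i%:R)).
  rewrite mulr_sumr; apply: eq_bigr => i _; rewrite big_map /= /bump /= add1n.
  have -> : \prod_(j <- s) (j.1 + j.2 + j.2 * i%:R) = \prod_(j <- s) (j.1 + j.2 * i.+1%:R).
    by apply: eq_bigr => j _; rewrite -natr1; ring.
  have := mul_bin_diag d.+1 i; rewrite /= => /(congr1 (fun k => k%:R : rat)).
  rewrite !natrM => bE.
  by rewrite exprS [_ * i.+1%:R]mulrC -bE; ring.
by rewrite IH ?mulr0 // size_map.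
Qed.

Lemma prod_iota0 (k : nat) (F : nat -> rat) :
  \prod_(r <- iota 0 k) F r = \prod_(r < k) F r.
Proof. by rewrite -{1}[k]subn0 -[iota 0 _]/(index_iota 0 k) big_mkord. Qed.

Lemma ffact_prodr (a k : nat) : (a ^_ k)%:R = \prod_(r < k) (a%:R - r%:R) :> rat.
Proof.
elim: k => [|k IH]; first by rewrite big_ord0.
rewrite ffactnSr big_ord_recr /= natrM IH.
have [ka|ak] := leqP k a; first by rewrite natrB.
by rewrite -IH ffact_small // !mul0r.
Qed.

(** Since b - k' = N - (a - k), this is the factorial formula for the binomial, multiplied out. Out
    of range the binomial and a falling factorial vanish together, so the identity covers all [k]
    and [k']. *)
Lemma binz_ffact (N a b k k' : nat) : (a + b = N + k + k')%N ->
  (binz N (a%:Z - k%:Z) * (a`! * b`!) = N`! * (a ^_ k * b ^_ k'))%N.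
Proof.
move=> abE; have [ka|ak] := leqP k a; last first.
  rewrite [a ^_ k]ffact_small // mul0n muln0 (_ : a%:Z - k%:Z = Negz (k - a.+1)) //.
  by rewrite NegzE; lia.
rewrite subzn //=; have [kb|bk] := leqP k' b; last first.
  by rewrite [b ^_ k']ffact_small // !muln0 bin_small //; lia.
have cN : (a - k <= N)%N by lia.
have := bin_fact cN; rewrite -(ffact_fact ka) -(ffact_fact kb).
by have -> : (b - k' = N - (a - k))%N by [lia]; move=> <-; ring.
Qed.

Lemma binz_ffactR (N a b k k' : nat) : (a + b = N + k + k')%N ->
  (binz N (a%:Z - k%:Z))%:R * (a`!%:R * b`!%:R)
  = N`!%:R * ((a ^_ k)%:R * (b ^_ k')%:R) :> rat.
Proof. by move=> /binz_ffact; rewrite -!natrM => ->. Qed.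

(* Here n' = n - 1, which avoids truncated subtractions. *)
Definition ker_coef (n' d i : nat) : rat :=
  (-1) ^+ i * 'C(d, i)%:R * ((n'.+1 + d - i)`!%:R * (n' + i)`!%:R).

Definition ker_poly (n' d : nat) : {poly rat} := \poly_(i < d.+1) ker_coef n' d i.
Definition rev_ker_poly (n' d : nat) : {poly rat} :=
  \poly_(i < d.+1) ker_coef n' d (d - i).

(** The value of row 0, the only one of the rows 0 to [d] that the kernel vector does not
    annihilate; see [ker_poly_head]. *)
Definition ker_norm (n' d : nat) : rat :=
  (n'.+1 + n'.+1 + d)`!%:R * (d`!%:R * n'`!%:R / (n'.+1 + d)`!%:R).

Lemma coef_at_poly t s d (F : nat -> rat) :
  coef_at t s (\poly_(i < d) F i) = \sum_(i < d) F i * (binz t (s%:Z - i%:Z))%:R.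
Proof.
rewrite (coef_at_expand _ _ (size_poly _ _)); apply: eq_bigr => i _.
by rewrite coef_poly ltn_ord coef_at_Xn.
Qed.

(** The factorials in [ker_coef] turn C(2n, n + j - i) into (2n)! times falling factorials of orders
    d - j and j - 1, a polynomial in i of degree d - 1. *)
Lemma ker_poly_eq0 (n' d j : nat) : (0 < j <= d)%N ->
  coef_at (n'.+1 + n'.+1) (n'.+1 + j) (ker_poly n' d) = 0.
Proof.
move=> /andP[j0 jd]; rewrite coef_at_poly.
pose s := [seq ((n'.+1 + d - r)%:R, -1) | r <- iota 0 (d - j)] ++
          [seq (n'%:R - r%:R, 1) | r <- iota 0 j.-1] : seq (rat * rat).
have sd : (size s < d)%N by rewrite size_cat !size_map !size_iota; lia.
rewrite -[RHS](mulr0 (n'.+1 + n'.+1)`!%:R) -[X in _ = _ * X](fdiff_prod0 sd).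
rewrite mulr_sumr; apply: eq_bigr => -[i /= id] _.
rewrite ltnS in id.
have := @binz_ffactR (n'.+1 + n'.+1) (n'.+1 + d - i) (n' + i) (d - j) j.-1.
have -> : (n'.+1 + d - i)%:Z - (d - j)%:Z = (n'.+1 + j)%:Z - i%:Z by lia.
have -> : (n'.+1 + d - i + (n' + i) = n'.+1 + n'.+1 + (d - j) + j.-1)%N by lia.
move=> /(_ erefl) H.
rewrite /ker_coef -[LHS]mulrA [X in _ * X]mulrC H.
have -> : \prod_(c <- s) (c.1 + c.2 * i%:R) =
    ((n'.+1 + d - i) ^_ (d - j))%:R * ((n' + i) ^_ j.-1)%:R.
  rewrite big_cat !big_map /= !ffact_prodr; congr (_ * _).
    rewrite prod_iota0; apply: eq_bigr => r _.
    by rewrite !natrB ?natrD; [ring | lia | have := ltn_ord r; lia].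
  rewrite prod_iota0; apply: eq_bigr => r _.
  by rewrite natrD; ring.
by ring.
Qed.

Lemma alt_sum_binS (d : nat) (f : nat -> rat) :
  \sum_(i < d.+2) (-1) ^+ i * 'C(d.+1, i)%:R * f i =
  \sum_(i < d.+1) (-1) ^+ i * 'C(d, i)%:R * (f i - f i.+1).
Proof.
transitivity (\sum_(i < d.+2) (-1) ^+ i * 'C(d, i)%:R * f i
  - \sum_(i < d.+1) (-1) ^+ i * 'C(d, i)%:R * f i.+1).
  rewrite big_ord_recl [X in _ = X - _]big_ord_recl !bin0 -addrA; congr (_ + _).
  rewrite -sumrB; apply: eq_bigr => i _; rewrite lift0 binS natrD exprS.
  by ring.
rewrite big_ord_recr /= bin_small // mulr0 mul0r addr0 -sumrB.
by apply: eq_bigr => i _; ring.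
Qed.

(** This is the Beta integral of t^n (1 - t)^d expanded by the binomial theorem; the induction on
    [d] uses Pascal's rule. *)
Lemma alt_bin_inv (n d : nat) :
  \sum_(i < d.+1) (-1) ^+ i * 'C(d, i)%:R * (n.+1 + i)%:R^-1
  = (d`! * n`!)%:R / (n.+1 + d)`!%:R :> rat.
Proof.
elim: d n => [|d IH] n.
  rewrite big_ord_recl big_ord0 /= addr0 expr0 bin0 !mul1r fact0 mul1n addn0.
  rewrite factS natrM; field.
  by rewrite pnatr_eq0 -lt0n fact_gt0 addrC natr1 pnatr_eq0.
rewrite (alt_sum_binS d (fun i => (n.+1 + i)%:R^-1)).
under eq_bigr => i _ do rewrite mulrBr addnS -addSn.
rewrite sumrB !IH [(n.+1 + d.+1)%N]addnS [(n.+2 + d)%N]addSn.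
rewrite [(n.+1 + d).+1`!]factS [d.+1`!]factS [n.+1`!]factS.
move: (fact_gt0 (n.+1 + d)); move: (n.+1 + d)`! => f f0; rewrite !natrM.
have {}f0 : f%:R != 0 :> rat by rewrite pnatr_eq0 -lt0n.
have nd : n%:R + d%:R + 2 != 0 :> rat by rewrite -!natrD pnatr_eq0 addn2.
have -> : (n.+1 + d).+1%:R = n%:R + d%:R + 2 :> rat.
  by rewrite -addn1 !natrD -addn1 natrD; ring.
rewrite -[d.+1%:R]natr1 -[n.+1%:R]natr1.
by field; rewrite f0 nd.
Qed.

Lemma ker_poly_head (n' d : nat) :
  coef_at (n'.+1 + n'.+1) n'.+1 (ker_poly n' d) = ker_norm n' d.
Proof.
rewrite coef_at_poly.
pose s k := [seq (n'.+1%:R + r.+1%:R, -1) | r <- iota 0 k] : seq (rat * rat).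
pose N := (n'.+1 + n'.+1)%N.
(* For row 0 a denominator n + i remains. Each factor is n + k + 1 - i = (2n + k + 1) - (n + i); the
   second part cancels the denominator and leaves degree k < d, hence sum 0. *)
have step k : (k <= d)%N ->
   \sum_(i < d.+1) (-1) ^+ i * 'C(d, i)%:R *
     (\prod_(c <- s k) (c.1 + c.2 * i%:R) / (n'.+1 + i)%:R)
   = (\prod_(r < k) (N + r.+1)%:R) * ((d`! * n'`!)%:R / (n'.+1 + d)`!%:R).
  elim: k => [|k IH] kd.
    rewrite big_ord0 mul1r -alt_bin_inv; apply: eq_bigr => i _.
    by rewrite /s big_nil mul1r.
  rewrite [in RHS]big_ord_recr [RHS]mulrAC -IH 1?ltnW // [RHS]mulrC mulr_sumr.
  have sk : (size (s k) < d)%N by rewrite size_map size_iota.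
  rewrite -[RHS]subr0 -[X in _ = _ - X](fdiff_prod0 sk) -sumrB; apply: eq_bigr => i _.
  have -> : s k.+1 = s k ++ [:: (n'.+1%:R + k.+1%:R, -1)].
    by have := iotaD 0 k 1; rewrite addn1 /s => ->; rewrite map_cat.
  rewrite big_cat big_seq1 -[nat_of_ord ord_max]/k; move: (\prod_(_ <- _) _) => P; rewrite /fst /snd.
  have ni : (n'.+1 + i)%:R != 0 :> rat by rewrite pnatr_eq0.
  rewrite /N !natrD -!natr1 in ni *.
  by rewrite /=; field.
have dd := step d (leqnn d).
transitivity (N`!%:R * ((\prod_(r < d) (N + r.+1)%:R)
    * ((d`! * n'`!)%:R / (n'.+1 + d)`!%:R)) : rat); last first.
  have -> : \prod_(r < d) (N + r.+1)%:R = (N + d)`!%:R / N`!%:R :> rat.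
    elim: (d) => [|k IH]; first by rewrite big_ord0 addn0 divff // pnatr_eq0 -lt0n fact_gt0.
    by rewrite big_ord_recr /= IH addnS factS natrM; ring.
  have N0 : N`!%:R != 0 :> rat by rewrite pnatr_eq0 -lt0n fact_gt0.
  by rewrite mulrA [N`!%:R * _]mulrC divfK // /ker_norm natrM.
rewrite -dd mulr_sumr; apply: eq_bigr => -[i /= id] _; rewrite ltnS in id.
have := @binz_ffactR N (n'.+1 + d - i) (n'.+1 + i) d 0.
have -> : (n'.+1 + d - i)%:Z - d%:Z = n'.+1%:Z - i%:Z by lia.
rewrite [(n'.+1 + i)%N]addSn factS natrM -addSn ffactn0.
have -> : (n'.+1 + d - i + (n'.+1 + i) = N + d + 0)%N by rewrite /N; lia.
move=> /(_ erefl) H.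
have -> : \prod_(c <- s d) (c.1 + c.2 * i%:R) = ((n'.+1 + d - i) ^_ d)%:R.
  rewrite big_map ffact_prodr prod_iota0.
  rewrite [RHS](reindex_inj rev_ord_inj) /=; apply: eq_bigr => r _.
  have rd := ltn_ord r.
  by rewrite !natrB ?natrD; [ring | lia | lia].
have ni : (n'.+1 + i)%:R != 0 :> rat by rewrite pnatr_eq0.
rewrite /ker_coef; apply: (mulIf ni).
transitivity ((-1) ^+ i * 'C(d, i)%:R * ((binz N (n'.+1%:Z - i%:Z))%:R
  * ((n'.+1 + d - i)`!%:R * ((n'.+1 + i)%:R * (n' + i)`!%:R))) : rat); first by ring.
rewrite H; move: ni; move: (n'.+1 + i)%:R N`!%:R => w F w0.
by field.
Qed.

Lemma rev_ker_polyE (n' d j : nat) : (j <= d)%N ->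
  coef_at (n'.+1 + n'.+1) (n'.+1 + j) (rev_ker_poly n' d) =
  coef_at (n'.+1 + n'.+1) (n'.+1 + (d - j)) (ker_poly n' d).
Proof.
move=> jd; rewrite !coef_at_poly [RHS](reindex_inj rev_ord_inj) /=.
apply: eq_bigr => -[i /= id] _; rewrite subSS; congr (_ * (_ %:R)).
by rewrite -binz_sub; congr binz; lia.
Qed.

(** * The Dixon sum *)

Lemma binz_absorb (q a i : nat) :
  q.+1%:R * (binz q (a%:Z - i.+1%:Z))%:R
  = (a%:R - i%:R) * (binz q.+1 (a%:Z - i%:Z))%:R :> rat.
Proof.
have [ia|ai] := leqP i a; last first.
  rewrite (_ : a%:Z - i%:Z = Negz (i - a.+1)); last by rewrite NegzE; lia.
  by rewrite (_ : a%:Z - i.+1%:Z = Negz (i - a)) ?mulr0 //; rewrite NegzE; lia.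
rewrite -natrB // -(subnK ia) addnK; move: (a - i)%N => {ia}k.
rewrite (_ : (k + i)%N%:Z - i%:Z = k%:Z); last by lia.
case: k => [|k].
  by rewrite (_ : (0 + i)%N%:Z - i.+1%:Z = Negz 0) ?mulr0 ?mul0r //; lia.
rewrite (_ : (k.+1 + i)%N%:Z - i.+1%:Z = k%:Z); last by lia.
by rewrite -!natrM; congr (_%:R); apply: (mul_bin_diag q.+1).
Qed.

Lemma binz_pascal (q a i : nat) :
  (binz q.+1 (a%:Z - i%:Z))%:R =
  (binz q (a%:Z - i%:Z))%:R + (binz q (a%:Z - i.+1%:Z))%:R :> rat.
Proof. by rewrite binzS natrD; congr (_ + (binz _ _)%:R); lia. Qed.

Lemma binz_absorb_upper (q a i : nat) :
  q.+1%:R * (binz q (a%:Z - i%:Z))%:R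
  = (q.+1%:R - a%:R + i%:R) * (binz q.+1 (a%:Z - i%:Z))%:R :> rat.
Proof.
have := binz_absorb q a i; rewrite binz_pascal mulrDr => E.
have -> : q.+1%:R * (binz q (a%:Z - i%:Z))%:R =
  q.+1%:R * ((binz q (a%:Z - i%:Z))%:R + (binz q (a%:Z - i.+1%:Z))%:R)
  - q.+1%:R * (binz q (a%:Z - i.+1%:Z))%:R :> rat by ring.
by rewrite E; ring.
Qed.

(** The part of the kernel entries that is invariant under i -> 2m - i. *)
Definition weight (n' m i : nat) : rat :=
  (-1) ^+ i * 'C(2 * m, i)%:R * ((n' + 2 * m - i)`!%:R * (n' + i)`!%:R).

Lemma weight_step (n' m i : nat) : (i <= 2 * m)%N ->
  i.+1%:R * (n'%:R + 2 * m%:R - i%:R) * weight n' m i.+1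
  = - (2 * m%:R - i%:R) * (n'%:R + 1 + i%:R) * weight n' m i.
Proof.
move=> im; have := mul_bin_left (2 * m) i => /(congr1 (fun k => k%:R : rat)).
rewrite !natrM natrB // natrM => bE; rewrite /weight exprS.
have -> : (n' + i.+1)`!%:R = (n'%:R + 1 + i%:R) * (n' + i)`!%:R :> rat.
  by rewrite addnS factS natrM -natr1 natrD; ring.
move: im; rewrite leq_eqVlt => /orP[/eqP im|im].
  by rewrite -im bin_small // im natrM subrr; ring.
have -> : (n' + 2 * m - i)`!%:R =
    (n'%:R + 2 * m%:R - i%:R) * (n' + 2 * m - i.+1)`!%:R :> rat.
  rewrite (_ : (n' + 2 * m - i = (n' + 2 * m - i.+1).+1)%N); last by lia.
  rewrite factS natrM -natr1 natrB; last by lia.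
  by rewrite natrD natrM -natr1; ring.
transitivity (- ((n'%:R + 2 * m%:R - i%:R) * (-1) ^+ i
   * (i.+1%:R * 'C(2 * m, i.+1)%:R)
   * ((n' + 2 * m - i.+1)`!%:R * ((n'%:R + 1 + i%:R) * (n' + i)`!%:R))) : rat).
  by ring.
by rewrite bE; ring.
Qed.

Lemma binz_absorb2 (l a i : nat) :
  2 * (l%:R + 1) * (2 * l%:R + 1) * (binz (2 * l) (a%:Z - i.+1%:Z))%:R
  = (a%:R - i%:R) * (2 * l%:R + 2 - a%:R + i%:R)
    * (binz (2 * l.+1) (a%:Z - i%:Z))%:R :> rat.
Proof.
have lE : (2 * l.+1 = (2 * l).+2)%N by lia.
have := binz_absorb (2 * l) a i; have := binz_absorb_upper (2 * l).+1 a i.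
have -> : (2 * l).+2%:R = 2 * (l%:R + 1) :> rat by rewrite -lE natrM -[l.+1%:R]natr1.
have -> : (2 * l).+1%:R = 2 * l%:R + 1 :> rat by rewrite -natr1 natrM.
rewrite lE => E1 E2; rewrite -mulrA E2 mulrCA E1; ring.
Qed.

Lemma binz_shift (q a i : nat) :
  (q.+1%:R - a%:R + i%:R + 1) * (binz q.+1 (a%:Z - i.+1%:Z))%:R
  = (a%:R - i%:R) * (binz q.+1 (a%:Z - i%:Z))%:R :> rat.
Proof.
by rewrite -[RHS]binz_absorb binz_absorb_upper -[i.+1%:R]natr1 -!addrA.
Qed.

(** Up to normalisation the well-poised 3F2(-2m, n' + 1, -m - l; -2m - n', 1 + l - m; 1). *)
Definition dixon (n' m l : nat) : rat :=
  \sum_(i < (2 * m).+1) weight n' m i * (binz (2 * l) ((m + l)%:Z - i%:Z))%:R.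

(* Zeilberger's recurrence; the certificate is H. *)
Lemma dixon_rec (n' m l : nat) :
  2 * (2 * l%:R + 1) * (n'%:R - l%:R) * dixon n' m l =
  (n'%:R - l%:R + m%:R) * (m%:R + l%:R + 1) * dixon n' m l.+1.
Proof.
pose H (i : nat) : rat := i%:R * (l%:R + 1 + i%:R - m%:R) * (n'%:R + 1 + 2 * m%:R - i%:R)
  * (weight n' m i * (binz (2 * l.+1) ((m + l.+1)%:Z - i%:Z))%:R).
have l1 : l%:R + 1 != 0 :> rat by rewrite natr1 pnatr_eq0.
have term i : (i <= 2 * m)%N ->
  2 * (l%:R + 1) *
  (2 * (2 * l%:R + 1) * (n'%:R - l%:R)
     * (weight n' m i * (binz (2 * l) ((m + l)%:Z - i%:Z))%:R) -
   (n'%:R - l%:R + m%:R) * (m%:R + l%:R + 1)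
     * (weight n' m i * (binz (2 * l.+1) ((m + l.+1)%:Z - i%:Z))%:R))
  = H i.+1 - H i.
  move=> im; have lE : (2 * l.+1 = (2 * l).+2)%N by lia.
  have aE : (m + l.+1)%:R = m%:R + l%:R + 1 :> rat by rewrite natrD -natr1 addrA.
  have E1 := binz_absorb2 l (m + l.+1) i; rewrite aE in E1.
  have E2 := binz_shift (2 * l).+1 (m + l.+1) i; rewrite -lE aE natrM -[l.+1%:R]natr1 in E2.
  have W := weight_step n' im.
  have bE : (m + l)%:Z - i%:Z = (m + l.+1)%:Z - i.+1%:Z by lia.
  have -> : H i.+1 = - (2 * m%:R - i%:R) * (n'%:R + 1 + i%:R) * weight n' m i
     * ((m%:R + l%:R + 1 - i%:R) * (binz (2 * l.+1) ((m + l.+1)%:Z - i%:Z))%:R).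
    by rewrite -W -E2 /H -[i.+1%:R]natr1; ring.
  rewrite bE /H.
  transitivity ((2 * (n'%:R - l%:R) * weight n' m i)
     * (2 * (l%:R + 1) * (2 * l%:R + 1)
        * (binz (2 * l) ((m + l.+1)%:Z - i.+1%:Z))%:R)
     - 2 * (l%:R + 1) * ((n'%:R - l%:R + m%:R) * (m%:R + l%:R + 1))
        * (weight n' m i * (binz (2 * l.+1) ((m + l.+1)%:Z - i%:Z))%:R) : rat).
    by ring.
  by rewrite E1; ring.
have l2 : 2 * (l%:R + 1) != 0 :> rat by rewrite mulf_neq0.
apply/eqP; rewrite -subr_eq0; apply/eqP; apply: (mulfI l2); rewrite mulr0.
rewrite /dixon !mulr_sumr -sumrB mulr_sumr.
transitivity (\sum_(0 <= i < (2 * m).+1) (H i.+1 - H i)).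
  by rewrite big_mkord; apply: eq_bigr => i _; rewrite -term // -ltnS.
rewrite telescope_sumr // /H /weight bin_small // !(mulr0, mul0r); ring.
Qed.

(** For l = 0 only the central term i = m survives, and the recurrence does the rest. It stops at l
    = n', where its factor n' - l vanishes. *)
Lemma dixon_closed (n' m l : nat) : (l <= n')%N ->
  dixon n' m l * (m`!%:R * l`!%:R * (m + l)`!%:R * (n' - l)`!%:R) =
  (-1) ^+ m * (2 * m)`!%:R * (2 * l)`!%:R * n'`!%:R * (n' + m)`!%:R
  * (n' - l + m)`!%:R.
Proof.
elim: l => [|l IH] ln.
  rewrite /dixon muln0 addn0 subn0 fact0.
  have mm : (m < (2 * m).+1)%N by lia.
  rewrite (bigD1 (Ordinal mm)) //= big1 ?addr0 => [|i im]; last first.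
    rewrite binz0 (_ : (m%:Z - i%:Z == 0) = false) ?mulr0 //.
    by move: im; rewrite -val_eqE /=; lia.
  rewrite subrr mulr1 /weight (_ : (n' + 2 * m - m = n' + m)%N); last by lia.
  have m2 : (m <= 2 * m)%N by lia.
  have := bin_fact m2; rewrite (_ : (2 * m - m = m)%N); last by lia.
  move=> <-; rewrite !natrM mulr1.
  by move: m`!%:R n'`!%:R (n' + m)`!%:R 'C(_, _)%:R => f1 f2 f3 f4; ring.
have rec := dixon_rec n' m l; have {IH} := IH (ltnW ln).
have [k kE] : exists k, n' = (l + k.+1)%N by exists (n' - l.+1)%N; lia.
have -> : (n' - l = k.+1)%N by rewrite kE addKn.
have -> : (n' - l.+1 = k)%N by rewrite kE addnS -addSn addKn.
rewrite (_ : n'%:R - l%:R = k%:R + 1 :> rat) in rec; last first.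
  by rewrite kE natrD -natr1; ring.
rewrite [(k.+1 + m)%N]addSn [(m + l.+1)%N]addnS [k.+1`!]factS [(k + m).+1`!]factS.
rewrite [(m + l).+1`!]factS [l.+1`!]factS (_ : (2 * l.+1 = (2 * l).+2)%N); last by lia.
rewrite [(2 * l).+2`!]factS [(2 * l).+1`!]factS.
have natE (a b : nat) : (a + b).+1%:R = a%:R + b%:R + 1 :> rat.
  by rewrite -natr1 natrD.
rewrite !natrM [(k + m).+1%:R]natE [(m + l).+1%:R]natE -[k.+1%:R]natr1.
rewrite -[l.+1%:R]natr1.
have -> : (2 * l).+2%:R = 2 * l%:R + 2 :> rat by rewrite -addn2 natrD natrM.
have -> : (2 * l).+1%:R = 2 * l%:R + 1 :> rat by rewrite -natr1 natrM.
move: (2 * m)`!%:R (2 * l)`!%:R n'`!%:R (n' + m)`!%:R => A B C D.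
move: m`!%:R l`!%:R (m + l)`!%:R k`!%:R (k + m)`!%:R => f1 f2 f3 f4 f5 IH.
have k1 : k%:R + 1 != 0 :> rat by rewrite natr1 pnatr_eq0.
have km : k%:R + m%:R + 1 != 0 :> rat by rewrite -natrD natr1 pnatr_eq0.
apply: (mulIf k1); apply: (mulIf km).
transitivity ((k%:R + 1 + m%:R) * (m%:R + l%:R + 1) * dixon n' m l.+1
  * ((l%:R + 1) * (f1 * f2 * f3 * ((k%:R + 1) * f4)))); first by ring.
rewrite -rec.
transitivity (dixon n' m l * (f1 * f2 * f3 * ((k%:R + 1) * f4))
  * (2 * (2 * l%:R + 1) * (k%:R + 1) * (l%:R + 1))); first by ring.
by rewrite IH; ring.
Qed.

Lemma weight_rev (n' m i : nat) : (i <= 2 * m)%N ->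
  weight n' m (2 * m - i) = weight n' m i.
Proof.
move=> im; rewrite /weight bin_sub // -signr_odd oddB // mul2n odd_double /= signr_odd.
rewrite (_ : (n' + m.*2 - (m.*2 - i) = n' + i)%N); last by lia.
rewrite (_ : (n' + (m.*2 - i) = n' + m.*2 - i)%N); last by lia.
by rewrite [X in _ * X = _]mulrC.
Qed.

(* Scalar products of the weights with row 2l + 1 centred at m + 1/2; the
   weights are symmetric about m. *)
Definition half0 (n' m l : nat) : rat := \sum_(i < (2 * m).+1)
  weight n' m i * (binz (2 * l).+1 ((m + l.+1)%:Z - i%:Z))%:R.

Definition half1 (n' m l : nat) : rat := \sum_(i < (2 * m).+1)
  (i%:R - m%:R) * weight n' m i * (binz (2 * l).+1 ((m + l.+1)%:Z - i%:Z))%:R.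

Lemma binz_rev (m l i : nat) : (i <= 2 * m)%N ->
  binz (2 * l).+1 ((m + l.+1)%:Z - (2 * m - i)%:Z) =
  binz (2 * l).+1 ((m + l.+1)%:Z - i.+1%:Z).
Proof. by move=> im; rewrite -binz_sub; congr binz; lia. Qed.

Lemma half0_rev (n' m l : nat) : half0 n' m l = \sum_(i < (2 * m).+1)
  weight n' m i * (binz (2 * l).+1 ((m + l.+1)%:Z - i.+1%:Z))%:R.
Proof.
rewrite /half0 (reindex_inj rev_ord_inj); apply: eq_bigr => -[i im] _.
by rewrite [nat_of_ord _]/= subSS -[nat_of_ord _]/i binz_rev ?weight_rev.
Qed.

Lemma half1_rev (n' m l : nat) : half1 n' m l = \sum_(i < (2 * m).+1)
  (m%:R - i%:R) * weight n' m i
  * (binz (2 * l).+1 ((m + l.+1)%:Z - i.+1%:Z))%:R.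
Proof.
rewrite /half1 (reindex_inj rev_ord_inj); apply: eq_bigr => -[i im] _.
rewrite [nat_of_ord _]/= subSS -[nat_of_ord _]/i binz_rev ?weight_rev // natrB // natrM.
by congr (_ * _ * _); ring.
Qed.

(** Adding the reflected sum combines two neighbouring entries of row 2l + 1 into one of row 2l +
    2. *)
Lemma half0E (n' m l : nat) : 2 * half0 n' m l = dixon n' m l.+1.
Proof.
rewrite mulr2n mulrDl mul1r {2}half0_rev -big_split; apply: eq_bigr => i _ /=.
by rewrite -mulrDr (_ : (2 * l.+1 = (2 * l).+2)%N) ?binz_pascal //; lia.
Qed.

(** Adding the reflected sum leaves, up to a factor l + 1, row 2l + 2 multiplied by (i - m)^2; and
    (l + 1)^2 - (i - m)^2 is the factor that lowers row 2l + 2 to row 2l. *)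
Lemma half1E (n' m l : nat) : 2 * half1 n' m l =
  (l%:R + 1) * dixon n' m l.+1 - 2 * (2 * l%:R + 1) * dixon n' m l.
Proof.
have l1 : 2 * (l%:R + 1) != 0 :> rat by rewrite mulf_neq0 // natr1 pnatr_eq0.
apply: (mulfI l1).
have h2 (q : rat) : 2 * q = q + q by ring.
rewrite [2 * half1 _ _ _]h2 {2}half1_rev -big_split /= /dixon.
rewrite !mulr_sumr -sumrB !mulr_sumr; apply: eq_bigr => -[i /= im] _.
have lE : (2 * l.+1 = (2 * l).+2)%N by lia.
have aE : (m + l.+1)%:R = m%:R + l%:R + 1 :> rat by rewrite natrD -natr1 addrA.
have rE : (2 * l).+2%:R = 2 * (l%:R + 1) :> rat by rewrite -lE natrM -[l.+1%:R]natr1.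
have E1 := binz_absorb2 l (m + l.+1) i; rewrite aE in E1.
have E2 := binz_absorb (2 * l).+1 (m + l.+1) i; rewrite rE -lE aE in E2.
have E3 := binz_absorb_upper (2 * l).+1 (m + l.+1) i; rewrite rE -lE aE in E3.
have -> : (m + l)%:Z - i%:Z = (m + l.+1)%:Z - i.+1%:Z by lia.
move: E1 E2 E3.
move: (weight _ _ _) (binz (2 * l) _)%:R (binz (2 * l.+1) _)%:R
  (binz (2 * l).+1 _)%:R (binz (2 * l).+1 _)%:R => w b0 b2 b1' b1 E1 E2 E3.
transitivity ((i%:R - m%:R) * w * ((2 * (l%:R + 1) * b1') - (2 * (l%:R + 1) * b1))).
  by ring.
transitivity (2 * (l%:R + 1) * (l%:R + 1) * w * b2
   - 2 * w * (2 * (l%:R + 1) * (2 * l%:R + 1) * b0)); last by ring.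
by rewrite E1 E2 E3; ring.
Qed.

Lemma ker_coef_even (n' m i : nat) : (i <= 2 * m)%N ->
  ker_coef n' (2 * m) i = (n'%:R + 1 + 2 * m%:R - i%:R) * weight n' m i.
Proof.
move=> im; rewrite /ker_coef /weight.
rewrite (_ : (n'.+1 + 2 * m - i = (n' + 2 * m - i).+1)%N); last by lia.
rewrite factS natrM -natr1 natrB; last by lia.
by rewrite natrD natrM; ring.
Qed.

(** Since (2m + 2) C(2m + 1, i) = (2m + 2 - i) C(2m + 2, i), the odd kernel reduces to the weights
    centred at m + 1. *)
Lemma ker_coef_odd (n' m i : nat) : (i <= (2 * m).+1)%N ->
  2 * (m%:R + 1) * ker_coef n' (2 * m).+1 i =
  (2 * (m%:R + 1) - i%:R) * weight n' m.+1 i.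
Proof.
move=> im; rewrite /ker_coef /weight.
have mE : (2 * m.+1 = (2 * m).+2)%N by lia.
rewrite mE (_ : (n'.+1 + (2 * m).+1 = n' + (2 * m).+2)%N); last by lia.
have rE : (2 * m).+2%:R = 2 * (m%:R + 1) :> rat by rewrite -mE natrM -[m.+1%:R]natr1.
have i2 : (i <= (2 * m).+2)%N by apply: leqW.
have := mul_bin_down (2 * m).+2 i => /(congr1 (fun k => k%:R : rat)).
rewrite [LHS]natrM [RHS]natrM natrB // rE -[(2 * m).+2.-1]/((2 * m).+1) => bE.
transitivity ((-1) ^+ i * (2 * (m%:R + 1) * 'C((2 * m).+1, i)%:R)
  * ((n' + (2 * m).+2 - i)`!%:R * (n' + i)`!%:R) : rat); first by ring.
by rewrite bE; ring.
Qed.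

Lemma coef_at_ker_even (n' m l : nat) :
  coef_at (2 * l).+1 (m + l.+1) (ker_poly n' (2 * m)) =
  (n'%:R + 1 + m%:R) * half0 n' m l - half1 n' m l.
Proof.
rewrite coef_at_poly mulr_sumr -sumrB; apply: eq_bigr => -[i /= im] _.
by rewrite ker_coef_even //; ring.
Qed.

Lemma coef_at_rev_ker_even (n' m l : nat) :
  coef_at (2 * l).+1 (m + l.+1) (rev_ker_poly n' (2 * m)) =
  (n'%:R + 1 + m%:R) * half0 n' m l + half1 n' m l.
Proof.
rewrite coef_at_poly half0_rev half1_rev mulr_sumr -big_split.
rewrite (reindex_inj rev_ord_inj); apply: eq_bigr => -[i im] _.
rewrite [nat_of_ord _]/= subSS -[nat_of_ord _]/i binz_rev // subKn //.
by rewrite ker_coef_even //=; ring.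
Qed.

Lemma coef_at_ker_odd (n' m l : nat) :
  2 * (m%:R + 1) * coef_at (2 * l).+1 (m.+1 + l.+1) (ker_poly n' (2 * m).+1) =
  (m%:R + 1) * half0 n' m.+1 l - half1 n' m.+1 l.
Proof.
have mE : (2 * m.+1 = (2 * m).+2)%N by lia.
(* The sums for [m.+1] have one more term, i = 2m + 2, where the linear factor vanishes. *)
rewrite coef_at_poly /half0 /half1 !mulr_sumr -sumrB mE [RHS]big_ord_recr.
rewrite -[nat_of_ord ord_max]/((2 * m).+2).
have -> : (2 * m).+2%:R = 2 * (m%:R + 1) :> rat by rewrite -mE natrM -[m.+1%:R]natr1.
rewrite -[m.+1%:R]natr1 -[LHS]addr0; congr (_ + _); last by ring.
apply: eq_bigr => -[i im] _; rewrite -[nat_of_ord _]/i mulrA ker_coef_odd //.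
by move: (weight _ _ _) (binz _ _)%:R => w b; ring.
Qed.

Lemma coef_at_rev_ker_odd (n' m l : nat) :
  2 * (m%:R + 1) * coef_at (2 * l).+1 (m + l.+1) (rev_ker_poly n' (2 * m).+1) =
  (m%:R + 1) * half0 n' m.+1 l + half1 n' m.+1 l.
Proof.
have mE : (2 * m.+1 = (2 * m).+2)%N by lia.
rewrite coef_at_poly half0_rev half1_rev !mulr_sumr -big_split mE [RHS]big_ord_recr /=.
have -> : (2 * m).+2%:R = 2 * (m%:R + 1) :> rat by rewrite -mE natrM -[m.+1%:R]natr1.
rewrite -[m.+1%:R]natr1 -[LHS]addr0; congr (_ + _); last by ring.
rewrite (reindex_inj rev_ord_inj); apply: eq_bigr => -[i im] _.
rewrite [nat_of_ord _]/= subSS subKn // -[nat_of_ord _]/i mulrA ker_coef_odd //.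
have -> : binz (2 * l).+1 ((m + l.+1)%N%:Z - ((2 * m).+1 - i)%N%:Z) =
    binz (2 * l).+1 ((m.+1 + l.+1)%N%:Z - i.+1%:Z).
  by rewrite -binz_sub; congr binz; lia.
by move: (weight _ _ _) (binz _ _)%:R => w b; ring.
Qed.

(** * Descending along the axis *)

Lemma natr_fact_neq0 (k : nat) : k`!%:R != 0 :> rat.
Proof. by rewrite pnatr_eq0 -lt0n fact_gt0. Qed.

Lemma ker_norm_neq0 (n' d : nat) : ker_norm n' d != 0.
Proof. by rewrite !mulf_neq0 ?invr_neq0 ?natr_fact_neq0. Qed.

Lemma ker_coef0 (n' d : nat) : ker_coef n' d 0 = (n'.+1 + d)`!%:R * n'`!%:R.
Proof. by rewrite /ker_coef expr0 bin0 !mul1r subn0 addn0. Qed.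

Lemma ker_coef0_neq0 (n' d : nat) : ker_coef n' d 0 != 0.
Proof. by rewrite ker_coef0 mulf_neq0 ?natr_fact_neq0. Qed.

(** * The Toeplitz matrix: columns of its inverse, determinant, rank-one change *)

Definition toeplitz (n' d : nat) : 'M[rat]_d :=
  \matrix_(i, j) coef_at (n'.+1 + n'.+1) (n'.+1 + i) 'X^j.

(** The four polynomials serve as [al], [be], [G0] and [G1]: kernel vectors of order [d] scaled to
    columns of the inverse, and those of order [d.+1] scaled to end coefficient 1. *)
Definition first_col n' d := (ker_norm n' d)^-1 *: ker_poly n' d.
Definition last_col n' d := (ker_norm n' d)^-1 *: rev_ker_poly n' d.
Definition low_ker n' d := (ker_coef n' d.+1 0)^-1 *: ker_poly n' d.+1.
Definition high_ker n' d := (ker_coef n' d.+1 0)^-1 *: rev_ker_poly n' d.+1.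

Lemma first_colE (n' d j : nat) : (j <= d)%N ->
  coef_at (n'.+1 + n'.+1) (n'.+1 + j) (first_col n' d) = (j == 0%N)%:R.
Proof.
move=> jd; rewrite coef_atZ; case: j jd => [|j] jd.
  by rewrite addn0 ker_poly_head mulVf ?ker_norm_neq0.
by rewrite ker_poly_eq0 ?mulr0.
Qed.

Lemma last_colE (n' d j : nat) : (j <= d)%N ->
  coef_at (n'.+1 + n'.+1) (n'.+1 + j) (last_col n' d) = (j == d)%:R.
Proof.
move=> jd; rewrite coef_atZ rev_ker_polyE // -coef_atZ first_colE ?leq_subr //.
by congr (nat_of_bool _)%:R; rewrite subn_eq0 [RHS]eqn_leq jd.
Qed.

Lemma low_kerE (n' d j : nat) : (j <= d)%N ->
  coef_at (n'.+1 + n'.+1) (n'.+1 + j).+1 (low_ker n' d) = 0.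
Proof. by move=> jd; rewrite coef_atZ -addnS ker_poly_eq0 ?mulr0. Qed.

Lemma high_kerE (n' d j : nat) : (j <= d)%N ->
  coef_at (n'.+1 + n'.+1) (n'.+1 + j) (high_ker n' d) = 0.
Proof.
move=> jd; rewrite coef_atZ rev_ker_polyE ?leqW // ker_poly_eq0 ?mulr0 //.
by rewrite subn_gt0 ltnS jd leq_subr.
Qed.

Lemma low_ker0 (n' d : nat) : (low_ker n' d)`_0 = 1.
Proof. by rewrite coefZ coef_poly mulVf ?ker_coef0_neq0. Qed.

Lemma high_ker_lead (n' d : nat) : (high_ker n' d)`_d.+1 = 1.
Proof. by rewrite coefZ coef_poly ltnSn subnn mulVf ?ker_coef0_neq0. Qed.

Lemma toeplitz_mul (n' d : nat) (f : {poly rat}) : (size f <= d)%N ->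
  toeplitz n' d *m (\col_(i < d) f`_i) =
  \col_(i < d) coef_at (n'.+1 + n'.+1) (n'.+1 + i) f.
Proof.
move=> fd; apply/colP => i; rewrite !mxE (coef_at_expand _ _ fd).
by apply: eq_bigr => j _; rewrite !mxE mulrC.
Qed.

(** Cramer's rule for the corner entry of the inverse: deleting the first row and column leaves the
    Toeplitz matrix of the next smaller size. *)
Lemma det_toeplitzS (n' d : nat) :
  (first_col n' d)`_0 * \det (toeplitz n' d.+1) = \det (toeplitz n' d).
Proof.
have fd : (size (first_col n' d) <= d.+1)%N.
  by rewrite (leq_trans (size_scale_leq _ _)) ?size_poly.
have := mul_adj_mx (toeplitz n' d.+1).
move=> /(congr1 (mulmx^~ (\col_(i < d.+1) (first_col n' d)`_i))).
rewrite /= -mulmxA toeplitz_mul // mul_scalar_mx => /colP/(_ ord0).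
rewrite !mxE mulrC => <-; rewrite big_ord_recl big1 ?addr0 => [|i _]; last first.
  by rewrite [X in _ * X]mxE first_colE ?mulr0 // -ltnS.
rewrite [X in _ * X]mxE first_colE // mulr1 mxE /cofactor addn0 expr0 mul1r.
congr (\det _); apply/matrixP => i j; rewrite !mxE !lift0 [(n'.+1 + i.+1)%N]addnS.
by rewrite exprS coef_at_mulX.
Qed.

Lemma first_col_head (n' d : nat) : (first_col n' d)`_0 =
  (n'.+1 + d)`!%:R ^+ 2 / ((n'.+1 + n'.+1 + d)`!%:R * d`!%:R).
Proof.
rewrite coefZ coef_poly ltn0Sn ker_coef0 /ker_norm.
move: (natr_fact_neq0 (n'.+1 + d)) (natr_fact_neq0 (n'.+1 + n'.+1 + d)).
move: (natr_fact_neq0 d) (natr_fact_neq0 n').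
move: (n'.+1 + d)`!%:R (n'.+1 + n'.+1 + d)`!%:R d`!%:R n'`!%:R => a b c e ? ? ? ?.
by field; apply/and4P.
Qed.

Lemma det_toeplitz (n' d : nat) : \det (toeplitz n' d) =
  \prod_(k < d) ((n'.+1 + n'.+1 + k)`!%:R * k`!%:R / (n'.+1 + k)`!%:R ^+ 2).
Proof.
elim: d => [|d IH]; first by rewrite det_mx00 big_ord0.
rewrite big_ord_recr -IH -(det_toeplitzS n' d) first_col_head.
rewrite -[nat_of_ord ord_max]/d.
move: (natr_fact_neq0 (n'.+1 + d)) (natr_fact_neq0 (n'.+1 + n'.+1 + d)).
move: (natr_fact_neq0 d).
move: (n'.+1 + d)`!%:R (n'.+1 + n'.+1 + d)`!%:R d`!%:R => a b c ? ? ?.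
by rewrite /=; field; apply/and3P.
Qed.

Lemma toeplitz_unit (n' d : nat) : toeplitz n' d \in unitmx.
Proof.
rewrite unitmxE unitfE det_toeplitz; apply/prodf_neq0 => k _.
by rewrite !mulf_neq0 ?invr_neq0 ?expf_neq0 ?natr_fact_neq0.
Qed.

(** One block matrix has two block triangular factorisations, through either Schur complement. *)
Lemma det_rank1 (F : fieldType) (d : nat) (y : 'cV[F]_d) (v : 'rV[F]_d) :
  \det (1%:M - y *m v) = 1 - (v *m y) 0 0.
Proof.
have E1 : block_mx 1%:M v y 1%:M =
    block_mx 1%:M 0 y 1%:M *m block_mx (1%:M : 'M[F]_1) v 0 (1%:M - y *m v).
  by rewrite mulmx_block !(mul1mx, mulmx1, mul0mx, mulmx0, addr0, add0r) addrC subrK.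
have E2 : block_mx 1%:M v y 1%:M =
    block_mx ((1%:M : 'M[F]_1) - v *m y) v 0 1%:M *m block_mx 1%:M 0 y 1%:M.
  by rewrite mulmx_block !(mul1mx, mulmx1, mul0mx, mulmx0, addr0, add0r) subrK.
have := congr1 (fun A => \det A) E1; rewrite {1}E2 !det_mulmx !det_lblock !det_ublock.
by rewrite !det1 !mul1r !mulr1 det_mx11 !mxE => <-.
Qed.

Lemma det_toeplitz_rank1 (n' d t s t' s' : nat) (y : {poly rat}) :
  represents n' d t s y ->
  \det (\matrix_(i < d.+1, j < d.+1)
    (coef_at (n'.+1 + n'.+1) (n'.+1 + i) 'X^j
     - coef_at t s 'X^i * coef_at t' s' 'X^j)) =
  \det (toeplitz n' d.+1) * (1 - coef_at t' s' y).
Proof.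
move=> [sy yE].
pose v : 'rV[rat]_d.+1 := \row_j coef_at t' s' 'X^j.
have -> : coef_at t' s' y = (v *m \col_(i < d.+1) y`_i) 0 0.
  rewrite mxE (coef_at_expand _ _ sy); apply: eq_bigr => i _.
  by rewrite !mxE mulrC.
rewrite -det_rank1 -det_mulmx mulmxBr mulmx1 mulmxA toeplitz_mul //.
congr (\det _); apply/matrixP => i j; rewrite !mxE big_ord1 !mxE.
by rewrite yE // -ltnS.
Qed.

Section Probability.
Variables (n' m : nat).
Local Notation d := (2 * m)%N.

Let dot_a l := coef_at (2 * l).+1 (m + l.+1) (first_col n' d).
Let dot_b l := coef_at (2 * l).+1 (m + l.+1) (last_col n' d).
Let dot_g l := coef_at (2 * l).+1 (m.+1 + l.+1) (low_ker n' d).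
Let dot_h l := coef_at (2 * l).+1 (m + l.+1) (high_ker n' d).

(** The proportion of the hexagon's tilings that contain the top lozenge of the line;
    [lozenge_prob_step] is the change from one lozenge to the next. *)
Definition lozenge_prob_base : rat :=
  (last_col n' d)`_m * dot_h n' - (low_ker n' d)`_m.+1 * dot_a n'.

Definition lozenge_prob_step (p q : nat) : rat :=
  dot_a p * dot_g q + dot_b p * dot_h q - dot_g p * dot_a q - dot_h p * dot_b q.

Lemma size_kers :
  [/\ size (first_col n' d) <= d.+1, size (last_col n' d) <= d.+1,
      size (low_ker n' d) <= d.+2 & size (high_ker n' d) <= d.+2]%N.
Proof.
by split; rewrite (leq_trans (size_scale_leq _ _)) ?size_poly.
Qed.

Lemma represents_axis : exists y, represents n' d 0 m y.
Proof.
pose Y := invmx (toeplitz n' d.+1) *m \col_(i < d.+1) coef_at 0 m 'X^i.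
pose y := \poly_(i < d.+1) Y (inord i) 0.
have YE : \col_(i < d.+1) y`_i = Y.
  by apply/colP => i; rewrite mxE coef_poly ltn_ord inord_val.
exists y; split; first exact: size_poly.
move=> j jd; have := toeplitz_mul n' (size_poly _ _ : (size y <= d.+1)%N).
rewrite YE mulmxA mulmxV ?toeplitz_unit // mul1mx.
have jd' : (j < d.+1)%N by [].
by move=> /colP/(_ (Ordinal jd')); rewrite !mxE.
Qed.

(** Raising [l] lengthens u by two rows and shortens v by two, which is the exchange of rows in
    [represents_down]. *)
Lemma represents_near_axis (l : nat) : (l <= n')%N ->
  exists2 y, represents n' d (2 * l).+1 (m + l.+1) y &
  1 - coef_at (2 * (n' - l)).+1 (m + (n' - l).+1) y =
  lozenge_prob_base + \sum_(1 <= e < l.+1) lozenge_prob_step e.-1 (n' - e).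
Proof.
have [s1 s2 s3 s4] := size_kers.
elim: l => [|l IH] ln.
  have [y yR] := represents_axis.
  have [y' y'R y'E] := represents_right s1 s2 s3 s4 (@first_colE n' d)
    (@last_colE n' d) (low_ker0 n' d) (high_ker_lead n' d) (@low_kerE n' d)
    (@high_kerE n' d) yR.
  exists y'; first by rewrite muln0 addn1.
  rewrite y'E subn0 big_geq // addr0 (_ : (2 * n').+2 = n'.+1 + n'.+1)%N; last by lia.
  rewrite (_ : (m + n'.+1 = n'.+1 + m)%N); last by lia.
  (* The pairing is row m of the equations for [y], hence equal to 1. It cancels the 1 and leaves
     two boundary products. *)
  rewrite yR.2; last by lia.
  rewrite /coef_at expr0 !mul1r coefXn eqxx /lozenge_prob_base /dot_a /dot_h /coef_at.
  rewrite (_ : (m + n'.+1 = n'.+1 + m)%N); last by lia.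
  rewrite mulr1n; ring.
have [y yR yE] := IH (ltnW ln).
have [y' y'R y'E] := represents_down s1 s2 s3 s4 (@first_colE n' d)
    (@last_colE n' d) (low_ker0 n' d) (high_ker_lead n' d) (@low_kerE n' d)
    (@high_kerE n' d) yR.
exists y'; first by rewrite mulnS add2n addnS.
rewrite big_nat_recr //= addrA -yE y'E /lozenge_prob_step /dot_a /dot_b /dot_g /dot_h.
have [q qE] : exists q, (n' - l)%N = q.+1 by exists (n' - l.+1)%N; lia.
have -> : (n' - l.+1)%N = q by lia.
rewrite qE [(2 * q.+1)%N]mulnS add2n [(m + q.+2)%N]addnS.
by rewrite -[(m + l.+1).+1]addSn -[(m + q.+1).+1]addSn; ring.
Qed.

End Probability.

(** The recurrence merges the two Dixon sums of [half1E] into one. The factor n' - l vanishes at l =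
    n', which is why the base value needs its own computation. *)
Lemma half1_closed (n' m l : nat) :
  (n'%:R - l%:R) * (2 * half1 n' m l) = - m%:R * (n'%:R + 1 + m%:R) * dixon n' m l.+1.
Proof.
have := dixon_rec n' m l; rewrite half1E => E.
transitivity ((n'%:R - l%:R) * (l%:R + 1) * dixon n' m l.+1
  - 2 * (2 * l%:R + 1) * (n'%:R - l%:R) * dixon n' m l); first by ring.
by rewrite E; ring.
Qed.

Lemma dixon_ratio (n' m l : nat) : (l <= n')%N ->
  (m%:R + l%:R + 1) * dixon n' m.+1 l =
  - 2 * (2 * m%:R + 1) * (n'%:R + m%:R + 1) * (n'%:R - l%:R + m%:R + 1) * dixon n' m l.
Proof.
move=> ln; have := dixon_closed m.+1 ln; have := dixon_closed m ln.
rewrite -natrB // (_ : (2 * m.+1 = (2 * m).+2)%N); last by lia.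
rewrite ![(_ + m.+1)%N]addnS [(m.+1 + l)%N]addSn exprS.
move: (n' - l)%N => k.
rewrite [m.+1`!]factS [(m + l).+1`!]factS [(2 * m).+2`!]factS [(2 * m).+1`!]factS.
rewrite [(n' + m).+1`!]factS [(k + m).+1`!]factS !natrM.
have natE (a b : nat) : (a + b).+1%:R = a%:R + b%:R + 1 :> rat.
  by rewrite -natr1 natrD.
rewrite [(n' + m).+1%:R]natE [(m + l).+1%:R]natE [(k + m).+1%:R]natE -[m.+1%:R]natr1.
have -> : (2 * m).+2%:R = 2 * (m%:R + 1) :> rat by rewrite -addn2 natrD natrM; ring.
have -> : (2 * m).+1%:R = 2 * m%:R + 1 :> rat by rewrite -natr1 natrM.
move: (natr_fact_neq0 m) (natr_fact_neq0 l) (natr_fact_neq0 (m + l)) (natr_fact_neq0 k).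
move: (2 * m)`!%:R (2 * l)`!%:R n'`!%:R (n' + m)`!%:R (k + m)`!%:R => A B C D E.
move: m`!%:R l`!%:R (m + l)`!%:R k`!%:R => f1 f2 f3 f4 h1 h2 h3 h4 E1 E2.
have m1 : m%:R + 1 != 0 :> rat by rewrite natr1 pnatr_eq0.
have h : (m%:R + 1) * (f1 * f2 * f3 * f4) != 0 by rewrite !mulf_neq0.
apply: (mulIf h).
transitivity (dixon n' m.+1 l * ((m%:R + 1) * f1 * f2 * ((m%:R + l%:R + 1) * f3) * f4)).
  by ring.
rewrite E2.
transitivity (- 2 * (2 * m%:R + 1) * (n'%:R + m%:R + 1) * (k%:R + m%:R + 1)
  * (m%:R + 1) * (dixon n' m l * (f1 * f2 * f3 * f4))); last by ring.
by rewrite E1; ring.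
Qed.

(** Both [p] and [q] are below n', so [half1_closed] can be divided by n' - p = q + 1 and n' - q = p
    + 1. Each of the eight pairings becomes a rational multiple of a single Dixon sum. *)
Lemma lozenge_prob_step_dixon (m p q : nat) (n' := (p + q.+1)%N) :
  lozenge_prob_step n' m p q =
  (ker_norm n' (2 * m) * ker_coef n' (2 * m).+1 0)^-1
  * ((n'%:R + 1 + m%:R) / 4)
  * (1 + m%:R * (n'%:R + 2 + m%:R) / ((p%:R + 1) * (q%:R + 1)))
  * (dixon n' m p.+1 * dixon n' m.+1 q.+1 - dixon n' m.+1 p.+1 * dixon n' m q.+1).
Proof.
have p1 : p%:R + 1 != 0 :> rat by rewrite natr1 pnatr_eq0.
have q1 : q%:R + 1 != 0 :> rat by rewrite natr1 pnatr_eq0.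
have m1 : m%:R + 1 != 0 :> rat by rewrite natr1 pnatr_eq0.
have nE : n'%:R = p%:R + q%:R + 1 :> rat by rewrite /n' natrD -natr1 addrA.
have h0E m' l : half0 n' m' l = dixon n' m' l.+1 / 2 by rewrite -half0E; field.
have h1p m' : half1 n' m' p =
    - m'%:R * (n'%:R + 1 + m'%:R) * dixon n' m' p.+1 / (2 * (q%:R + 1)).
  by rewrite -half1_closed nE; field.
have h1q m' : half1 n' m' q =
    - m'%:R * (n'%:R + 1 + m'%:R) * dixon n' m' q.+1 / (2 * (p%:R + 1)).
  by rewrite -half1_closed nE; field.
have g l : coef_at (2 * l).+1 (m.+1 + l.+1) (ker_poly n' (2 * m).+1) =
    ((m%:R + 1) * half0 n' m.+1 l - half1 n' m.+1 l) / (2 * (m%:R + 1)).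
  by rewrite -coef_at_ker_odd; field.
have h l : coef_at (2 * l).+1 (m + l.+1) (rev_ker_poly n' (2 * m).+1) =
    ((m%:R + 1) * half0 n' m.+1 l + half1 n' m.+1 l) / (2 * (m%:R + 1)).
  by rewrite -coef_at_rev_ker_odd; field.
rewrite /lozenge_prob_step !coef_atZ !coef_at_ker_even !coef_at_rev_ker_even !g !h.
rewrite !h0E !h1p !h1q -[m.+1%:R]natr1 nE.
move: (ker_norm_neq0 n' (2 * m)) (ker_coef0_neq0 n' (2 * m).+1).
move: (ker_norm _ _) (ker_coef _ _ _) => Z k0 hZ hk.
move: (dixon _ _ _) (dixon _ _ _) (dixon _ _ _) (dixon _ _ _) => Y1 Y2 Y3 Y4.
by field; rewrite ?hZ ?hk ?p1 ?q1 ?m1.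
Qed.

(** The signs square to 1, and as n' - (p + 1) = q the factorials of m + p and m + q cancel
    crosswise. *)
Lemma dixon_mul (m p q : nat) (n' := (p + q.+1)%N) :
  dixon n' m p.+1 * dixon n' m q.+1 =
  ((2 * m)`!%:R * n'`!%:R * (n' + m)`!%:R / m`!%:R) ^+ 2
  * ((2 * p.+1)`!%:R * (2 * q.+1)`!%:R)
  / ((p%:R + 1) * p`!%:R ^+ 2 * ((q%:R + 1) * q`!%:R ^+ 2)
     * (m%:R + p%:R + 1) * (m%:R + q%:R + 1)).
Proof.
have pn : (p.+1 <= n')%N by rewrite /n' addnS ltnS leq_addr.
have qn : (q.+1 <= n')%N by rewrite /n' leq_addl.
have := dixon_closed m qn; have := dixon_closed m pn.
have -> : (n' - p.+1 = q)%N by rewrite /n' addnS -addSn addKn.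
have -> : (n' - q.+1 = p)%N by rewrite /n' addnK.
rewrite ![(m + _.+1)%N]addnS [(m + p).+1`!]factS [(m + q).+1`!]factS.
rewrite [p.+1`!]factS [q.+1`!]factS.
rewrite [((m + p).+1 * _)%:R]natrM [((m + q).+1 * _)%:R]natrM.
rewrite [(p.+1 * p`!)%:R]natrM [(q.+1 * q`!)%:R]natrM.
have natE (a b : nat) : (a + b).+1%:R = a%:R + b%:R + 1 :> rat.
  by rewrite -natr1 natrD.
rewrite [(m + p).+1%:R]natE [(m + q).+1%:R]natE -[p.+1%:R]natr1 -[q.+1%:R]natr1.
have p1 : p%:R + 1 != 0 :> rat by rewrite natr1 pnatr_eq0.
have q1 : q%:R + 1 != 0 :> rat by rewrite natr1 pnatr_eq0.
have mp : m%:R + p%:R + 1 != 0 :> rat by rewrite -natE pnatr_eq0.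
have mq : m%:R + q%:R + 1 != 0 :> rat by rewrite -natE pnatr_eq0.
rewrite [(q + m)%N]addnC [(p + m)%N]addnC.
move: (natr_fact_neq0 m) (natr_fact_neq0 p) (natr_fact_neq0 q).
move: (natr_fact_neq0 (m + p)) (natr_fact_neq0 (m + q)).
move: (2 * m)`!%:R n'`!%:R (n' + m)`!%:R (2 * p.+1)`!%:R (2 * q.+1)`!%:R => A B C E F.
move: m`!%:R p`!%:R q`!%:R (m + p)`!%:R (m + q)`!%:R => f1 f2 f3 f4 f5 h4 h5 h1 h2 h3.
move: (dixon _ _ _) (dixon _ _ _) => Xq Xp E1 E2.
have ss : (-1) ^+ m * (-1) ^+ m = 1 :> rat by rewrite -expr2 sqrr_sign.
set Dp := (X in _ * X = _) in E1; set Dq := (X in _ * X = _) in E2.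
have Dp0 : Dp != 0 by rewrite /Dp !mulf_neq0.
have Dq0 : Dq != 0 by rewrite /Dq !mulf_neq0.
apply: (mulIf Dp0); apply: (mulIf Dq0).
transitivity ((Xp * Dp) * (Xq * Dq)); first by ring.
rewrite E1 E2.
transitivity ((-1) ^+ m * (-1) ^+ m * (A * E * B * C * f5 * (A * F * B * C * f4))).
  by ring.
rewrite ss /Dp /Dq; field.
by rewrite ?h1 ?h2 ?h3 ?p1 ?q1 ?mp ?mq.
Qed.

(** * Pochhammer symbols and the comparison with the summands of sigma_2 *)

Lemma pochS (a : rat) (e : nat) : poch a e.+1 = poch a e * (a + e%:R).
Proof. by rewrite /poch big_ord_recr. Qed.

Lemma poch_nat (a e : nat) : poch (a%:R + 1) e = (a + e)`!%:R / a`!%:R.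
Proof.
elim: e => [|e IH]; first by rewrite /poch big_ord0 addn0 divff ?natr_fact_neq0.
by rewrite pochS IH addnS factS natrM -natr1 natrD; ring.
Qed.

Lemma fact_doubleS (k : nat) : (2 * k.+1)`!%:R =
  2 * (k%:R + 1) * (2 * k%:R + 1) * (2 * k)`!%:R :> rat.
Proof.
rewrite (_ : (2 * k.+1 = (2 * k).+2)%N); last by lia.
rewrite [(2 * k).+2`!]factS [(2 * k).+1`!]factS.
rewrite [((2 * k).+2 * _)%:R]natrM [((2 * k).+1 * _)%:R]natrM.
have -> : (2 * k).+2%:R = 2 * (k%:R + 1) :> rat by rewrite -addn2 natrD natrM; ring.
have -> : (2 * k).+1%:R = 2 * k%:R + 1 :> rat by rewrite -natr1 natrM.
by rewrite mulrA.
Qed.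

Lemma natr_factS (k : nat) : k.+1`!%:R = (k%:R + 1) * k`!%:R :> rat.
Proof. by rewrite [k.+1`!]factS natrM natr1. Qed.

Lemma poch_half (e : nat) : poch (1 / 2) e = (2 * e)`!%:R / (4 ^+ e * e`!%:R).
Proof.
elim: e => [|e IH]; first by rewrite /poch big_ord0.
rewrite pochS IH fact_doubleS natr_factS exprS.
have e1 : e%:R + 1 != 0 :> rat by rewrite natr1 pnatr_eq0.
have p4 : 4 ^+ e != 0 :> rat by rewrite expf_neq0.
move: (natr_fact_neq0 e) p4; move: (2 * e)`!%:R e`!%:R (4 ^+ e) => a b c hb hc.
by field; rewrite hb hc e1.
Qed.

Lemma poch_half_sub (n e f : nat) : n = (e + f)%N -> poch (1 / 2 - n%:R) e =
  (-1) ^+ e * ((2 * n)`!%:R * f`!%:R) / (4 ^+ e * n`!%:R * (2 * f)`!%:R).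
Proof.
elim: e f => [|e IH] f nE.
  rewrite nE add0n /poch big_ord0 !expr0 !mul1r [X in _ = X / _]mulrC divff //.
  by rewrite mulf_neq0 ?natr_fact_neq0.
rewrite pochS (IH f.+1) ?addnS // fact_doubleS natr_factS !exprS.
have -> : n%:R = e%:R + f%:R + 1 :> rat by rewrite nE addSn -natr1 natrD.
have f1 : f%:R + 1 != 0 :> rat by rewrite natr1 pnatr_eq0.
have f2 : 2 * f%:R + 1 != 0 :> rat by rewrite -natrM natr1 pnatr_eq0.
have p4 : 4 ^+ e != 0 :> rat by rewrite expf_neq0.
move: (natr_fact_neq0 n) (natr_fact_neq0 (2 * f)) p4.
move: (2 * n)`!%:R n`!%:R f`!%:R (2 * f)`!%:R (4 ^+ e) => a b c g h hb hg hh.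
by field; rewrite ?hb ?hg ?hh ?f1 ?f2.
Qed.

Definition sigma2_term (N m e : nat) : rat :=
  (-1) ^+ e * 'C(N.-1, e)%:R * div_self_add m e
     * ((N%:R - 2 * e%:R - 1) * poch (1 / 2) e)
     / ((m%:R + N%:R - e%:R - 1) * poch (3 / 2 - N%:R) e)
  + (m%:R + N%:R) * ((-1) ^+ e * 'C(N.-1, e)%:R
     * ((N%:R - 2 * e%:R - 1) * poch (1 / 2) e)
     / ((m%:R + e%:R + 1) * (m%:R + N%:R - e%:R) * poch (3 / 2 - N%:R) e)).

Lemma sigma2_sum (N m l : nat) : sigma2 N m l = \sum_(0 <= e < l) sigma2_term N m e.
Proof. by rewrite /sigma2 mulr_sumr -big_split. Qed.

(** With N = p + q + 3 and e = p + 1 one has N - 2e - 1 = q - p, and 3/2 - N = 1/2 - (N - 1) makes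
    [poch_half_sub] applicable. *)
Lemma sigma2_term_closed (m p q : nat) (n' := (p + q.+1)%N) :
  sigma2_term n'.+2 m p.+1 =
  n'.+1`!%:R ^+ 2 * ((2 * p.+1)`!%:R * (2 * q.+1)`!%:R)
  / ((p.+1`!%:R * q.+1`!%:R) ^+ 2 * (2 * n'.+1)`!%:R) * (q%:R - p%:R)
  * (m%:R / ((m%:R + p%:R + 1) * (m%:R + q%:R + 1))
     + (m%:R + p%:R + q%:R + 3) / ((m%:R + p%:R + 2) * (m%:R + q%:R + 2))).
Proof.
have nE : n'.+1 = (p.+1 + q.+1)%N by rewrite /n' addSn.
have nr : n'.+2%:R = p%:R + q%:R + 3 :> rat.
  by rewrite /n' -!natr1 natrD -natr1; ring.
have pE := poch_half_sub nE.
have p3 : poch (3 / 2 - n'.+2%:R) p.+1 = poch (1 / 2 - n'.+1%:R) p.+1.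
  by congr poch; rewrite -[n'.+2%:R]natr1; field.
have ne : (p.+1 <= n'.+1)%N by rewrite nE leq_addr.
have := bin_fact ne; rewrite (_ : (n'.+1 - p.+1 = q.+1)%N); last by rewrite nE addKn.
move=> /(congr1 (fun k => k%:R : rat)); rewrite natrM [(p.+1`! * _)%:R]natrM => bE.
rewrite /sigma2_term p3 pE poch_half nr -[n'.+2.-1]/n'.+1.
have -> : div_self_add m p.+1 = m%:R / (m%:R + p%:R + 1).
  by rewrite /div_self_add /= natrD -natr1 addrA.
rewrite -[p.+1%:R]natr1.
have natE (a b k : nat) : a%:R + b%:R + k.+1%:R != 0 :> rat.
  by rewrite -!natrD pnatr_eq0 addnS.
have m1 : m%:R + p%:R + 1 != 0 :> rat := natE m p 0%N.
have m2 : m%:R + q%:R + 1 != 0 :> rat := natE m q 0%N.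
have m3 : m%:R + p%:R + 2 != 0 :> rat := natE m p 1%N.
have m4 : m%:R + q%:R + 2 != 0 :> rat := natE m q 1%N.
have p4 : 4 ^+ p.+1 != 0 :> rat by rewrite expf_neq0.
have sp : (-1) ^+ p.+1 != 0 :> rat by rewrite signr_eq0.
move: bE (natr_fact_neq0 p.+1) (natr_fact_neq0 q.+1) (natr_fact_neq0 n'.+1).
move: (natr_fact_neq0 (2 * n'.+1)) (natr_fact_neq0 (2 * q.+1)) p4 sp.
move: (2 * n'.+1)`!%:R (2 * p.+1)`!%:R (2 * q.+1)`!%:R => V E F.
move: n'.+1`!%:R p.+1`!%:R q.+1`!%:R 'C(_, _)%:R (4 ^+ p.+1) ((-1) ^+ p.+1).
move=> Nf Pf Qf B p4 s hV hF hp4 hs <- hP hQ hN.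
rewrite !mulf_eq0 !negb_or in hN; case/and3P: hN => hB _ _.
by field; rewrite ?hV ?hF ?hp4 ?hs ?hP ?hQ ?hB ?m1 ?m2 ?m3 ?m4.
Qed.

Definition near_axis_const (n' m : nat) : rat :=
  (poch (m%:R + 1) n'.+1 * poch (m%:R + 1) n'.+1 * poch (n'.+2%:R - 1) n'.+1)
  / (poch (2 * m%:R + 2) n'.+1 * poch (2 * m%:R + n'.+2%:R) n'.+1 * n'.+1`!%:R).

Lemma near_axis_const_closed (n' m : nat) : near_axis_const n' m =
  ((m%:R + n'%:R + 1) * (n' + m)`!%:R / m`!%:R) ^+ 2
  * ((2 * n'.+1)`!%:R / (2 * (n'%:R + 1) * n'`!%:R))
  * ((2 * m%:R + 1) * (2 * m)`!%:R)
  / ((2 * m%:R + n'%:R + 2) * (n'.+1 + n'.+1 + 2 * m)`!%:R * ((n'%:R + 1) * n'`!%:R)).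
Proof.
rewrite /near_axis_const.
have -> : n'.+2%:R - 1 = n'%:R + 1 :> rat by rewrite -!natr1; ring.
have -> : 2 * m%:R + 2 = (2 * m).+1%:R + 1 :> rat by rewrite -[(2 * m).+1%:R]natr1 natrM; ring.
have -> : 2 * m%:R + n'.+2%:R = (n'.+1 + 2 * m)%:R + 1 :> rat.
  by rewrite natrD natrM -!natr1; ring.
rewrite !poch_nat.
have -> : (m + n'.+1 = (n' + m).+1)%N by lia.
have -> : ((2 * m).+1 + n'.+1 = (n'.+1 + 2 * m).+1)%N by lia.
have -> : (n'.+1 + 2 * m + n'.+1 = n'.+1 + n'.+1 + 2 * m)%N by lia.
have -> : (2 * n'.+1 = (n' + n'.+1).+1)%N by lia.
rewrite [(n' + m).+1`!%:R]natr_factS [(n'.+1 + 2 * m).+1`!%:R]natr_factS.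
rewrite [(n' + n'.+1).+1`!%:R]natr_factS [(2 * m).+1`!%:R]natr_factS [n'.+1`!%:R]natr_factS.
rewrite [(n' + m)%:R]natrD [(n' + n'.+1)%:R]natrD [(n'.+1 + 2 * m)%:R]natrD.
rewrite [(2 * m)%:R]natrM -[n'.+1%:R]natr1.
have n1 : n'%:R + 1 != 0 :> rat by rewrite natr1 pnatr_eq0.
have n2 : 2 * m%:R + n'%:R + 2 != 0 :> rat by rewrite -natrM -!natrD pnatr_eq0 addn2.
have m2 : 2 * m%:R + 1 != 0 :> rat by rewrite -natrM natr1 pnatr_eq0.
move: (natr_fact_neq0 (n' + m)) (natr_fact_neq0 m) (natr_fact_neq0 n').
move: (natr_fact_neq0 (n'.+1 + 2 * m)) (natr_fact_neq0 (n'.+1 + n'.+1 + 2 * m)).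
move: (natr_fact_neq0 (2 * m)).
move: (n'.+1 + n'.+1 + 2 * m)`!%:R (n'.+1 + 2 * m)`!%:R (n' + n'.+1)`!%:R (2 * m)`!%:R.
move: (n' + m)`!%:R m`!%:R n'`!%:R => C M0 B W U V A hA hU hW hC hM hB.
by field; rewrite ?hA ?hU ?hW ?hC ?hM ?hB ?n1 ?n2 ?m2.
Qed.

Lemma lozenge_prob_step_closed (m p q : nat) (n' := (p + q.+1)%N) :
  lozenge_prob_step n' m p q = near_axis_const n' m * sigma2_term n'.+2 m p.+1.
Proof.
rewrite near_axis_const_closed sigma2_term_closed lozenge_prob_step_dixon -/n'.
have pn : (p.+1 <= n')%N by rewrite /n' addnS ltnS leq_addr.
have qn : (q.+1 <= n')%N by rewrite /n' leq_addl.
have nr : n'%:R = p%:R + q%:R + 1 :> rat by rewrite /n' natrD -natr1 addrA.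
have natE (a b k : nat) : a%:R + b%:R + k.+1%:R != 0 :> rat.
  by rewrite -!natrD pnatr_eq0 addnS.
have m1 : m%:R + p%:R + 1 != 0 :> rat := natE m p 0%N.
have m2 : m%:R + q%:R + 1 != 0 :> rat := natE m q 0%N.
have m3 : m%:R + p%:R + 2 != 0 :> rat := natE m p 1%N.
have m4 : m%:R + q%:R + 2 != 0 :> rat := natE m q 1%N.
have Yp : dixon n' m.+1 p.+1 = - 2 * (2 * m%:R + 1) * (n'%:R + m%:R + 1)
    * (q%:R + m%:R + 1) * dixon n' m p.+1 / (m%:R + p%:R + 2).
  have := dixon_ratio m pn; rewrite -[p.+1%:R]natr1.
  have -> : n'%:R - (p%:R + 1) = q%:R :> rat by rewrite nr; ring.
  move=> <-; field; exact: m3.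
have Yq : dixon n' m.+1 q.+1 = - 2 * (2 * m%:R + 1) * (n'%:R + m%:R + 1)
    * (p%:R + m%:R + 1) * dixon n' m q.+1 / (m%:R + q%:R + 2).
  have := dixon_ratio m qn; rewrite -[q.+1%:R]natr1.
  have -> : n'%:R - (q%:R + 1) = p%:R :> rat by rewrite nr; ring.
  move=> <-; field; exact: m4.
have Xpq := dixon_mul m p q; rewrite -/n' in Xpq.
(* The bracket has numerator (p - q)(2m + p + q + 3), the origin of the factor N - 2e - 1 in
   sigma_2. *)
have -> : dixon n' m p.+1 * dixon n' m.+1 q.+1 - dixon n' m.+1 p.+1 * dixon n' m q.+1
  = - 2 * (2 * m%:R + 1) * (n'%:R + m%:R + 1)
    * ((p%:R + m%:R + 1) / (m%:R + q%:R + 2) - (q%:R + m%:R + 1) / (m%:R + p%:R + 2))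
    * (dixon n' m p.+1 * dixon n' m q.+1).
  by rewrite Yp Yq; ring.
rewrite Xpq ker_coef0 /ker_norm.
have -> : (n'.+1 + (2 * m).+1 = (n'.+1 + 2 * m).+1)%N by lia.
rewrite [(n'.+1 + 2 * m).+1`!%:R]natr_factS [n'.+1`!%:R]natr_factS.
rewrite [p.+1`!%:R]natr_factS [q.+1`!%:R]natr_factS.
rewrite [(n'.+1 + 2 * m)%:R]natrD [(2 * m)%:R]natrM -[n'.+1%:R]natr1.
have p1 : p%:R + 1 != 0 :> rat by rewrite natr1 pnatr_eq0.
have q1 : q%:R + 1 != 0 :> rat by rewrite natr1 pnatr_eq0.
have n1 : p%:R + q%:R + 1 + 1 != 0 :> rat by rewrite -natrD !natr1 pnatr_eq0.
have n2 : 2 * m%:R + (p%:R + q%:R + 1) + 2 != 0 :> rat.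
  by rewrite -natrM -[p%:R + q%:R]natrD natr1 -!natrD pnatr_eq0 addn2.
move: (natr_fact_neq0 (n' + m)) (natr_fact_neq0 m) (natr_fact_neq0 n').
move: (natr_fact_neq0 (n'.+1 + 2 * m)) (natr_fact_neq0 (n'.+1 + n'.+1 + 2 * m)).
move: (natr_fact_neq0 (2 * m)) (natr_fact_neq0 (2 * n'.+1)).
move: (natr_fact_neq0 p) (natr_fact_neq0 q).
rewrite !nr.
move: (n'.+1 + n'.+1 + 2 * m)`!%:R (n'.+1 + 2 * m)`!%:R (2 * n'.+1)`!%:R (2 * m)`!%:R.
move: (n' + m)`!%:R m`!%:R n'`!%:R p`!%:R q`!%:R (2 * p.+1)`!%:R (2 * q.+1)`!%:R.
move=> C M0 B P Q E F W U V A hP hQ hA hV hU hW hC hM hB.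
by field; rewrite ?hP ?hQ ?hA ?hV ?hU ?hW ?hC ?hM ?hB ?p1 ?q1 ?n1 ?n2 ?m1 ?m2 ?m3 ?m4.
Qed.

Lemma lozenge_prob_base_closed (n' m : nat) :
  lozenge_prob_base n' m = near_axis_const n' m * sigma2_term n'.+2 m 0.
Proof.
have n1 : n'%:R + 1 != 0 :> rat by rewrite natr1 pnatr_eq0.
have m1 : m%:R + 1 != 0 :> rat by rewrite natr1 pnatr_eq0.
have mn : m%:R + n'%:R + 1 != 0 :> rat by rewrite -natrD natr1 pnatr_eq0.
have n2 : 2 * m%:R + n'%:R + 2 != 0 :> rat by rewrite -natrM -!natrD pnatr_eq0 addn2.
have sE : sigma2_term n'.+2 m 0 = (n'%:R + 1) / (m%:R + n'%:R + 1) + (n'%:R + 1) / (m%:R + 1).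
  rewrite /sigma2_term bin0 /div_self_add eqxx /poch !big_ord0 expr0.
  have mn2 : m%:R + n'%:R + 2 != 0 :> rat by rewrite -!natrD pnatr_eq0 addn2.
  have -> : n'.+2%:R = n'%:R + 2 :> rat by rewrite -addn2 natrD.
  by field; rewrite m1 mn addrA mn2.
(* At l = n' the left side of the recurrence is 0, so the next sum vanishes for positive [m]. For m
   = 0 that sum enters only with the factor m. *)
have X0 k : dixon n' k.+1 n'.+1 = 0.
  have := dixon_rec n' k.+1 n'; rewrite subrr mulr0 mul0r add0r => /esym/eqP.
  rewrite -natrD natr1 !mulf_eq0 !pnatr_eq0 /= => /eqP; exact.
have mX0 : m%:R * dixon n' m n'.+1 = 0.
  by case: m {n1 m1 mn n2 sE} => [|k]; rewrite ?mul0r ?X0 ?mulr0.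
have XE k : dixon n' k n' = (-1) ^+ k * (2 * k)`!%:R * (2 * n')`!%:R.
  have := dixon_closed k (leqnn n'); rewrite subnn add0n fact0 mulr1 [(k + n')%N]addnC.
  move: (natr_fact_neq0 k) (natr_fact_neq0 n') (natr_fact_neq0 (n' + k)).
  move: k`!%:R n'`!%:R (n' + k)`!%:R => f1 f2 f3 h1 h2 h3 E.
  have h : f1 * f2 * f3 != 0 by rewrite !mulf_neq0.
  by apply: (mulIf h); rewrite E; ring.
have aE : coef_at (2 * n').+1 (m + n'.+1) (ker_poly n' (2 * m)) =
    (2 * n'%:R + 1) * dixon n' m n'.
  rewrite coef_at_ker_even; have e0 := half0E n' m n'; have e1 := half1E n' m n'.
  have t2 : 2 != 0 :> rat by [].
  apply: (mulfI t2).
  transitivity ((n'%:R + 1 + m%:R) * (2 * half0 n' m n') - 2 * half1 n' m n').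
    by ring.
  rewrite e0 e1.
  transitivity (m%:R * dixon n' m n'.+1 + 2 * ((2 * n'%:R + 1) * dixon n' m n')).
    by ring.
  by rewrite mX0 add0r.
have hE : 2 * (m%:R + 1) * coef_at (2 * n').+1 (m + n'.+1) (rev_ker_poly n' (2 * m).+1) =
    - (2 * n'%:R + 1) * dixon n' m.+1 n'.
  rewrite coef_at_rev_ker_odd; have e0 := half0E n' m.+1 n'; have e1 := half1E n' m.+1 n'.
  have t2 : 2 != 0 :> rat by [].
  apply: (mulfI t2).
  transitivity ((m%:R + 1) * (2 * half0 n' m.+1 n') + 2 * half1 n' m.+1 n').
    by ring.
  by rewrite e0 e1 X0; ring.
have {}hE : coef_at (2 * n').+1 (m + n'.+1) (rev_ker_poly n' (2 * m).+1) =
    - (2 * n'%:R + 1) * dixon n' m.+1 n' / (2 * (m%:R + 1)).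
  by rewrite -hE; field.
rewrite near_axis_const_closed sE /lozenge_prob_base !coef_atZ aE hE !XE !coefZ !coef_poly.
rewrite fact_doubleS (_ : (m < (2 * m).+1)%N = true); last by lia.
rewrite (_ : (m.+1 < (2 * m).+2)%N = true); last by lia.
rewrite ker_coef0 /ker_norm /ker_coef.
rewrite (_ : (2 * m - m = m)%N); last by lia.
rewrite (_ : (n'.+1 + 2 * m - m = (n' + m).+1)%N); last by lia.
rewrite (_ : (n'.+1 + (2 * m).+1 - m.+1 = (n' + m).+1)%N); last by lia.
rewrite (_ : (n'.+1 + (2 * m).+1 = (n'.+1 + 2 * m).+1)%N); last by lia.
rewrite [(n' + m.+1)%N]addnS [(n' + m).+1`!%:R]natr_factS.
rewrite [(n'.+1 + 2 * m).+1`!%:R]natr_factS fact_doubleS.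
rewrite [(n' + m)%:R]natrD [(n'.+1 + 2 * m)%:R]natrD [(2 * m)%:R]natrM -[n'.+1%:R]natr1.
have b1 : 'C(2 * m, m)%:R = (2 * m)`!%:R / m`!%:R ^+ 2 :> rat.
  have m2 : (m <= 2 * m)%N by lia.
  have := bin_fact m2; rewrite (_ : (2 * m - m = m)%N); last by lia.
  move=> <-; rewrite !natrM; move: (natr_fact_neq0 m); move: m`!%:R => f h.
  by field.
have b2 : 'C((2 * m).+1, m.+1)%:R =
    (2 * m%:R + 1) * (2 * m)`!%:R / ((m%:R + 1) * m`!%:R ^+ 2) :> rat.
  have := mul_bin_diag (2 * m).+1 m => /(congr1 (fun k => k%:R : rat)).
  rewrite [LHS]natrM [RHS]natrM -[(2 * m).+1.-1]/(2 * m)%N b1.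
  have -> : (2 * m).+1%:R = 2 * m%:R + 1 :> rat by rewrite -natr1 natrM.
  rewrite -[m.+1%:R]natr1 => E; apply: (mulfI m1); rewrite -E.
  move: (natr_fact_neq0 m); move: m`!%:R => f h; by field; rewrite ?h ?m1.
rewrite b1 b2 !exprS.
have s1 : (-1) ^+ m = 1 :> rat \/ (-1) ^+ m = -1 :> rat.
  by rewrite -signr_odd; case: odd; [right | left]; rewrite ?expr1 ?expr0.
move: (natr_fact_neq0 (n' + m)) (natr_fact_neq0 m) (natr_fact_neq0 n').
move: (natr_fact_neq0 (n'.+1 + 2 * m)) (natr_fact_neq0 (n'.+1 + n'.+1 + 2 * m)).
move: (natr_fact_neq0 (2 * m)).
move: (n'.+1 + n'.+1 + 2 * m)`!%:R (n'.+1 + 2 * m)`!%:R (2 * m)`!%:R (2 * n')`!%:R.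
move: (n' + m)`!%:R m`!%:R n'`!%:R => C M0 B W U A V hA hU hW hC hM hB.
have n2' : n'%:R + 1 + 2 * m%:R + 1 != 0 :> rat.
  by rewrite (_ : _ + 1 = 2 * m%:R + n'%:R + 2) //; ring.
by case: s1 => ->; field; rewrite ?hA ?hU ?hW ?hC ?hM ?hB ?n1 ?n2 ?n2' ?m1 ?mn.
Qed.

(** * MacMahon's product, path counts and the conclusion *)

Lemma prod_ratio (c n : nat) : (0 < c)%N ->
  \prod_(1 <= j < n.+1) ((c + j)%:R / (c + j.-1)%:R) = (c + n)%:R / c%:R :> rat.
Proof.
move=> c0; have hc k : (c + k)%:R != 0 :> rat by rewrite pnatr_eq0 -lt0n addn_gt0 c0.
elim: n => [|n IH]; first by rewrite big_geq // addn0 divff // -[c]addn0.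
rewrite big_nat_recr //= IH.
move: (hc 0%N) (hc n); rewrite addn0; move: (c + n.+1)%:R (c + n)%:R c%:R => a b e h1 h2.
by field; rewrite h1.
Qed.

(** For fixed k the quotients telescope in j, and the product over i then builds up the factorials
    of the k-th factor of [det_toeplitz]. *)
Lemma macmahon_box (n d : nat) :
  \prod_(1 <= i < n.+1) \prod_(1 <= j < n.+1) \prod_(1 <= k < d.+1)
    ((i%:R + j%:R + k%:R - 1) / (i%:R + j%:R + k%:R - 2)) =
  \prod_(k < d) ((n + n + k)`!%:R * k`!%:R / (n + k)`!%:R ^+ 2) :> rat.
Proof.
under eq_bigr => i _ do rewrite exchange_big.
rewrite exchange_big /= big_add1 /= big_mkord; apply: eq_bigr => k _.
transitivity (\prod_(1 <= i < n.+1) ((i + k + n)%:R / (i + k)%:R) : rat).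
  apply: eq_big_nat => i /andP[i0 _]; rewrite -prod_ratio ?addn_gt0 ?i0 //.
  apply: eq_big_nat => j /andP[j0 _]; case: j j0 => // j _.
  congr (_ / _); rewrite /= !natrD -!natr1; ring.
have H r : \prod_(1 <= i < r.+1) ((i + k + n)%:R / (i + k)%:R) =
    (r + n + k)`!%:R * k`!%:R / ((n + k)`!%:R * (r + k)`!%:R) :> rat.
  elim: r => [|r IH].
    by rewrite big_geq // !add0n divff // mulf_neq0 ?natr_fact_neq0.
  rewrite big_nat_recr //= IH (_ : (r.+1 + k + n = (r + n + k).+1)%N); last by lia.
  rewrite (_ : (r.+1 + n + k = (r + n + k).+1)%N) ?[(r.+1 + k)%N]addSn; last by lia.
  rewrite [(r + n + k).+1`!%:R]natr_factS [(r + k).+1`!%:R]natr_factS.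
  rewrite -[(r + n + k).+1%:R]natr1 -[(r + k).+1%:R]natr1.
  have h : (r + k)%:R + 1 != 0 :> rat by rewrite natr1 pnatr_eq0.
  move: h (natr_fact_neq0 (n + k)) (natr_fact_neq0 (r + k)).
  move: (r + k)%:R (r + n + k)%:R (r + n + k)`!%:R k`!%:R (n + k)`!%:R (r + k)`!%:R.
  by move=> a b c e f g ? ? ?; field; apply/and3P.
by rewrite H expr2.
Qed.

(** All paths minus those through the blocked segment, which split there into an upper and a lower
    part. A path starting below height [h] cannot meet it. *)
Lemma path_count_closed (a0 : int) (h q : nat) (a j : int) : (0 < h)%N ->
  path_count (a0, h%:Z) q a j = (binz q (j - a))%:Z
  - (if (h <= q)%N then (binz (q - h) (a0 - a))%:Z * (binz h (j - a0))%:Z else 0).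
Proof.
move=> h0; elim: q a => [|q IH] a.
  rewrite leqNgt h0 subr0 binz0 /=; congr (nat_of_bool _)%:Z; lia.
have E (z : int) : z - (a + 1) = z - a - 1 by ring.
rewrite path_countS xpair_eqE; case: eqP => [aE|aa0] /=.
  case: eqP => [hE|hq].
    have -> : h = q.+1 by lia.
    by rewrite aE leqnn subnn subrr binz0 eqxx mul1r subrr.
  rewrite !IH !E binzS PoszD; case: (leqP h q) => hq'.
    by rewrite leqW // subSn // binzS PoszD; ring.
  by rewrite leqNgt ltn_neqAle hq' andbT (_ : q.+1 != h) //=; [ring | lia].
rewrite !IH !E binzS PoszD; case: (leqP h q) => hq.
  by rewrite leqW // subSn // binzS PoszD; ring.
move: hq; rewrite leq_eqVlt => /orP[/eqP <-|hq].
  rewrite leqnn subnn binz0 (_ : (a0 - a == 0) = false) ?mul0r; last by lia.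
  by ring.
by rewrite leqNgt hq /=; ring.
Qed.

Lemma V'E (n' m l : nat) : (l <= n')%N ->
  V' n'.+1 (2 * m).+1 l.+1 =
  hexagon (2 * m).+1 n'.+1 n'.+1 `\`
    vlozenge (m%:Z - n'%:Z + l%:Z, (2 * (n' - l)).+1%:Z).
Proof.
move=> ln; have ls : (l < size (iota 1 n'.+1))%N by rewrite size_iota ltnS.
have E : nth (0, 0) (right_lozenges n'.+1 (2 * m).+1) l =
    (m%:Z - n'%:Z + l%:Z, (2 * (n' - l)).+1%:Z).
  rewrite right_lozengesE (nth_map 0%N _ _ ls) nth_iota //.
  by congr (_, _); lia.
rewrite /V' -[l.+1.-1]/l E; reflexivity.
Qed.

(** Two of the three binomials are reflected, so that the entries of A read C(2n, n + i - j) and v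
    has the same form as u with [l] replaced by [n' - l]. *)
Lemma tilings_near_axis (n' m l : nat) : (l <= n')%N ->
  (M (V' n'.+1 (2 * m).+1 l.+1))%:R =
  \det (\matrix_(i < (2 * m).+1, j < (2 * m).+1)
    (coef_at (n'.+1 + n'.+1) (n'.+1 + i) 'X^j
     - coef_at (2 * l).+1 (m + l.+1) 'X^i
       * coef_at (2 * (n' - l)).+1 (m + (n' - l).+1) 'X^j)) :> rat.
Proof.
move=> ln; rewrite V'E // -[LHS]/((M _)%:Z%:~R : rat) tilings_det; last by move=> /=; lia.
rewrite -det_map_mx; congr (\det _); apply/matrixP => i j.
rewrite !mxE path_count_closed // !coef_at_Xn ifT; last by lia.
rewrite rmorphB rmorphM /= -!pmulrn; congr (_%:R - _%:R * _%:R).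
- by rewrite -binz_sub; congr binz; lia.
- by congr binz; lia.
- by rewrite -binz_sub; congr binz; lia.
Qed.

Unset Implicit Arguments.

Theorem theorem6p6 (m N l : nat) (hN : (1 < N)%N)
    (hl : (0 < l <= size (right_lozenges N.-1 (2 * m).+1))%N) :
  (M (V' N.-1 (2 * m).+1 l))%:R =
    (poch (m%:R + 1) N.-1 * poch (m%:R + 1) N.-1 * poch (N%:R - 1) N.-1)
    / (poch (2 * m%:R + 2) N.-1 * poch (2 * m%:R + N%:R) N.-1 * (N.-1)`!%:R)
    * sigma2 N m l
    * \prod_(1 <= i < N) \prod_(1 <= j < N) \prod_(1 <= k < (2 * m).+2)
        ((i%:R + j%:R + k%:R - 1) / (i%:R + j%:R + k%:R - 2)) :> rat.
Proof.
case: N hN hl => [|[|n']] // _; rewrite right_lozengesE size_map size_iota.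
case: l => [|l] // /andP[_ ln']; have {ln'} ln : (l <= n')%N := ln'.
rewrite -[n'.+2.-1]/n'.+1 -/(near_axis_const n' m).
rewrite macmahon_box -det_toeplitz tilings_near_axis //.
have [y yR yE] := represents_near_axis m ln.
rewrite (det_toeplitz_rank1 _ _ yR) yE mulrC; congr (_ * _).
(* The summand e = 0 belongs to the top lozenge, each later summand to the change from lozenge e to
   lozenge e + 1. *)
rewrite sigma2_sum [X in _ = _ * X]big_nat_recl // mulrDr -lozenge_prob_base_closed; congr (_ + _).
rewrite big_add1 mulr_sumr; apply: eq_big_nat => e /andP[_ el].
rewrite -[e.+1.-1]/e; have [q qE] : exists q, n' = (e + q.+1)%N.
  by exists (n' - e.+1)%N; lia.
by rewrite qE -lozenge_prob_step_closed addnS -addSn addKn.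
Qed.
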